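(* Let $f\colon X\to X$ be a cw-hyperbolic homeomorphism of a compact metric space $(X,d)$. Then: (1) $f$ admits only a finite number of distinct chain recurrent classes; (2) each chain recurrent class is either expansive or admits arbitrarily small totally disconnected topological semihorseshoes; (3) each chain recurrent class $C$ is transitive and admits a periodic decomposition into elementary sets $C_1,\dots,C_n$; (4) for each chain recurrent class $C$ with such a decomposition into elementary sets $C_1,\dots,C_n$, the map $f^n$ restricted to each elementary set is topologically mixing and satisfies both the specification property and the two-sided limit shadowing property.
   Context: Let $f$ be a homeomorphism of a compact metric space $(X,d)$. For $c>0$ and $x\in X$ put $W^s_c(x)=\{y\in X: d(f^n(x),f^n(y))\le c \text{ for all } n\ge 0\}$ and $W^u_c(x)=\{y\in X: d(f^{-n}(x),f^{-n}(y))\le c \text{ for all } n\ge 0\}$. Let $C^s_c(x)$ (resp. $C^u_c(x)$) be the connected component of $W^s_c(x)$ (resp. $W^u_c(x)$) containing $x$. $f$ is cw-expansive if there is $c>0$ such that $W^u_c(x)\cap W^s_c(x)$ is totally disconnected for every $x\in X$. $f$ satisfies the cw-local-product-structure if for each $\varepsilon>0$ there is $\delta>0$ such that $C^s_\varepsilon(x)\cap C^u_\varepsilon(y)\ne\emptyset$ whenever $d(x,y)<\delta$. $f$ is cw-hyperbolic if it is cw-expansive and satisfies the cw-local-product-structure. Standing convention: whenever $f$ is said to be cw-hyperbolic, $X$ is a Peano continuum (compact, connected, locally connected metric space). Chain recurrent classes: for $\varepsilon>0$, an $\varepsilon$-chain from $x$ to $y$ is a finite sequence $x=x_0,x_1,\dots,x_k=y$,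 $k\ge1$, with $d(f(x_i),x_{i+1})\le\varepsilon$ for $0\le i<k$. A point $x$ is chain recurrent if for every $\varepsilon>0$ there is an $\varepsilon$-chain from $x$ to $x$. On the set of chain recurrent points, $x\sim y$ if for every $\varepsilon>0$ there are $\varepsilon$-chains from $x$ to $y$ and from $y$ to $x$; the equivalence classes are the chain recurrent classes, which are compact and $f$-invariant. A class $C$ is expansive if $f|_C$ is expansive: there is $c>0$ such that $W^s_c(x)\cap W^u_c(x)\cap C=\{x\}$ for every $x\in C$. A class $C$ is transitive if $f|_C$ is topologically transitive. A class $C$ admits arbitrarily small totally disconnected topological semihorseshoes if for every $\varepsilon>0$ there are a compact totally disconnected set $K\subset C$ and an integer $k\ge1$ such that $f^k(K)=K$, $\operatorname{diam}(f^i(K))\le\varepsilon$ for every $i\in\mathbb{Z}$, and $f^k|_K$ is semiconjugate to the full shift on two symbols (there is a continuous surjection $h\colon K\to\{0,1\}^{\mathbb{Z}}$ with $h\circ f^k|_K=\sigma\circ h$, where $\sigma$ is the shift). A periodic decomposition of $C$ into elementary sets is a decomposition $C=C_1\cup\dots\cup C_n$ into pairwise disjoint nonempty compact sets with $f(C_i)=C_{i+1}$ for $1\le i<n$ and $f(C_n)=C_1$, such that $f^n|_{C_i}$ is topologically mixing for each $i$; the sets $C_i$ are called elementary sets. A homeomorphism $g$ of a compact metric space $(Y,d)$ has the specification property if for every $\varepsilon>0$ there is $L\in\mathbb{N}$ such that for every finite family of integer intervals $I_j=[a_j,b_j]$, $1\le j\le m$, with $a_{j+1}-b_j\ge L$ for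 $1\le j<m$, and all points $y_1,\dots,y_m\in Y$, there is $z\in Y$ with $d(g^i(z),g^i(y_j))\le\varepsilon$ for all $i\in I_j$ and all $j$. It has the two-sided limit shadowing property if for every sequence $(y_k)_{k\in\mathbb{Z}}$ in $Y$ with $d(g(y_k),y_{k+1})\to0$ as $|k|\to\infty$ there is $z\in Y$ with $d(g^k(z),y_k)\to0$ as $|k|\to\infty$. *)

(* Defs.v *)
From HB Require Import structures.
From mathcomp Require Import all_boot all_order all_algebra.
From mathcomp Require Import all_classical all_reals all_analysis.

Set Implicit Arguments.
Unset Strict Implicit.
Unset Printing Implicit Defensive.

Import Order.TTheory GRing.Theory Num.Theory.
Import numFieldNormedType.Exports.

Local Open Scope classical_set_scope.
Local Open Scope ring_scope.

Record homeo (X : topologicalType) := Homeo {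
  hfun :> X -> X ;
  hinv : X -> X ;
  hfunK : cancel hfun hinv ;
  hinvK : cancel hinv hfun ;
  hfun_continuous : continuous hfun ;
  hinv_continuous : continuous hinv
}.

Section HomeoIterates.
Variable X : topologicalType.

Lemma iter_cancel (g g' : X -> X) n :
  cancel g g' -> cancel (iter n g) (iter n g').
Proof. by move=> gK; elim: n => [|n IHn] x //; rewrite iterSr /= gK IHn. Qed.

Lemma iter_continuous (g : X -> X) n : continuous g -> continuous (iter n g).
Proof.
move=> cg; elim: n => [|n IHn] x /=; first exact: cvg_id.
exact: (continuous_comp (IHn x) (cg _)).
Qed.

Definition hiter (f : homeo X) (n : nat) : homeo X :=
  Homeo (iter_cancel n (@hfunK _ f)) (iter_cancel n (@hinvK _ f))
        (@iter_continuous _ n (@hfun_continuous _ f))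
        (@iter_continuous _ n (@hinv_continuous _ f)).

(* the integer iterate f^k *)
Definition hiterz (f : homeo X) (k : int) : X -> X :=
  match k with
  | Posz n => iter n f
  | Negz n => iter n.+1 (hinv f)
  end.

End HomeoIterates.

Definition locally_connected (X : topologicalType) :=
  forall (x : X) (U : set X), nbhs x U ->
    exists V : set X, [/\ open V, V x, connected V & V `<=` U].

Definition peano_continuum (X : topologicalType) :=
  [/\ compact [set: X], connected [set: X] & locally_connected X].

(* The full shift {0,1}^Z, with the product of the discrete topologies. *)
Definition shift_space : Type := prod_topology (fun _ : int => bool).

HB.instance Definition _ := Topological.on shift_space.

Definition shift_map (s : shift_space) : shift_space := fun i => s (i + 1).

Section CwDynamics.
Variables (R : realType) (X : metricType R).
Implicit Types (f g : homeo X) (A C K : set X) (c e : R) (x y z : X).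

Definition diam A : \bar R :=
  ereal_sup [set (mdist p.1 p.2)%:E | p in A `*` A].

Definition Ws f c x : set X :=
  [set y | forall n : nat, mdist (iter n f x) (iter n f y) <= c].

Definition Wu f c x : set X :=
  [set y | forall n : nat,
     mdist (iter n (hinv f) x) (iter n (hinv f) y) <= c].

Definition Cs f c x : set X := connected_component (Ws f c x) x.

Definition Cu f c x : set X := connected_component (Wu f c x) x.

Definition cw_expansive f :=
  exists2 c, 0 < c & forall x, totally_disconnected (Wu f c x `&` Ws f c x).

Definition cw_local_product_structure f :=
  forall e, 0 < e -> exists2 delta : R, 0 < delta &
    forall x y, mdist x y < delta -> Cs f e x `&` Cu f e y !=set0.

Definition cw_hyperbolic f := cw_expansive f /\ cw_local_product_structure f.

Definition eps_chain f e x y :=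
  exists (k : nat) (u : nat -> X), [/\ (0 < k)%N, u 0%N = x, u k = y &
    forall i : nat, (i < k)%N -> mdist (f (u i)) (u i.+1) <= e].

Definition chain_recurrent f x := forall e, 0 < e -> eps_chain f e x x.

Definition chain_equiv f x y :=
  forall e, 0 < e -> eps_chain f e x y /\ eps_chain f e y x.

Definition chain_recurrent_class f C :=
  exists2 x, chain_recurrent f x &
    C = [set y | chain_recurrent f y /\ chain_equiv f x y].

(* The predicates below express properties of the restriction of f (or g) to
   an invariant set, with the induced metric and topology; relatively open
   subsets of A are the A `&` U with U open in X. *)
Definition expansive_on f A :=
  exists2 c, 0 < c &
    forall x, A x -> Ws f c x `&` Wu f c x `&` A = [set x].

Definition transitive_on f A :=
  forall U V : set X, open U -> open V ->
    A `&` U !=set0 -> A `&` V !=set0 ->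
    exists n : nat, (iter n f @` (A `&` U)) `&` (A `&` V) !=set0.

Definition mixing_on f A :=
  forall U V : set X, open U -> open V ->
    A `&` U !=set0 -> A `&` V !=set0 ->
    exists N : nat, forall n : nat, (N <= n)%N ->
      (iter n f @` (A `&` U)) `&` (A `&` V) !=set0.

(* The semiconjugacy h is only constrained on K; its values elsewhere are
   irrelevant. *)
Definition small_td_semihorseshoes f C :=
  forall e, 0 < e -> exists (K : set X) (k : nat),
    [/\ [/\ compact K, totally_disconnected K & K `<=` C],
        (0 < k)%N,
        iter k f @` K = K,
        forall i : int, (diam (hiterz f i @` K) <= e%:E)%E &
        exists h : X -> shift_space,
          [/\ {within K, continuous h}, h @` K = [set: shift_space] &
              forall x, K x -> h (iter k f x) = shift_map (h x)]].

(* C_1, ..., C_n are indexed by 'I_n; ordS is the cyclic successor, so that the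
   last set is mapped onto the first one. The predicate partition of the
   library includes that the pieces are nonempty. *)
Definition elementary_decomposition f C (n : nat) (D : 'I_n -> set X) :=
  [/\ (0 < n)%N,
      partition [set: 'I_n] D C,
      forall i, compact (D i),
      forall i, f @` D i = D (ordS i) &
      forall i, mixing_on (hiter f n) (D i)].

(* The intervals [a_j, b_j] and points y_j, j = 1..m, are the values of a, b, y
   at 0..m-1. *)
Definition specification_on g A :=
  forall e, 0 < e -> exists L : nat,
    forall (m : nat) (a b : nat -> int) (y : nat -> X),
      (forall j : nat, (j < m)%N -> a j <= b j) ->
      (forall j : nat, (j.+1 < m)%N -> L%:Z <= a j.+1 - b j) ->
      (forall j : nat, (j < m)%N -> A (y j)) ->
      exists2 z, A z &
        forall j : nat, (j < m)%N -> forall i : int, a j <= i <= b j ->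
          mdist (hiterz g i z) (hiterz g i (y j)) <= e.

(* u k --> 0 as |k| --> oo *)
Definition vanishes_at_infinity (u : int -> R) :=
  (u n%:Z @[n --> \oo] --> (0 : R)) /\ (u (- n%:Z) @[n --> \oo] --> (0 : R)).

Definition two_sided_limit_shadowing_on g A :=
  forall y : int -> X, (forall k, A (y k)) ->
    vanishes_at_infinity (fun k => mdist (g (y k)) (y (k + 1))) ->
    exists2 z, A z & vanishes_at_infinity (fun k => mdist (hiterz g k z) (y k)).

End CwDynamics.

(* Main.v *)
Require Import Defs.
From mathcomp Require Import all_boot all_order all_algebra.
From mathcomp Require Import all_classical all_reals all_analysis.
From mathcomp Require Import ring lra zify.

Set Implicit Arguments.
Unset Strict Implicit.
Unset Printing Implicit Defensive.

Import Order.TTheory GRing.Theory Num.Theory.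
Import numFieldNormedType.Exports.

Local Open Scope classical_set_scope.
Local Open Scope ring_scope.

(** * Finiteness, decomposition and shadowing for cw-hyperbolic homeomorphisms

    By cw-expansiveness, connected sets whose forward images stay small are
    contracted at a uniform rate, because a limit of counterexamples would be a
    nontrivial connected set that stays small in both time directions
    ([cw_expansive_contraction]).  Hence the point that the local product
    structure attaches to two close points [x] and [y] is asymptotic to [x] in
    the future and to [y] in the past, uniformly ([cw_local_product]).  Bowen's
    construction then gives the shadowing property ([shadowing]), the union of
    the unstable continua used by the construction being controlled as a single
    connected set.

    The orbit of a local product point links the past of [y] to the future of
    [x].  Close chain recurrent points are therefore equivalent: the classes are
    uniformly isolated from each other, which makes them finitely many
    ([class_isolated], [finite_classes]) and lets points of a class shadow
    pseudo-orbits that start and end in it ([class_shadowing]).  Transitivity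
    follows.  Moreover the link has the same length as an orbit, so that the
    length of chains, modulo the period of the loops at a given scale, is
    constant on balls whose radius does not depend on the scale.  This bounds the
    periods, and the phase modulo the largest one cuts the class into relatively
    open pieces on which the return map is mixing ([class_decomposition]).

    If a class is not expansive, two local products produce, near a point [x] of
    the class, another point whose orbit is close to that of [x] and asymptotic
    to it at both ends ([doubly_asymptotic_pair]).  Following one orbit or the
    other gives two loops that can be concatenated arbitrarily, and the points
    that shadow the concatenations form the semihorseshoe
    ([class_semihorseshoes]).  It is totally disconnected since all its iterates
    are small.

    Finally an elementary set is a chain recurrent class of the power [f^n],
    which is again cw-hyperbolic ([cw_hyperbolic_hiter], [elementary_class]), so
    that it suffices to treat a mixing class.  Specification follows from
    shadowing along pseudo-orbits that mixing connects
    ([class_specification]).  For two-sided limit shadowing, one-sided limit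
    shadowing in the future and in the past ([limit_shadowing]) is glued, again
    by local products, along a connecting orbit ([class_limit_shadowing]). *)

(** * Limits along an ultrafilter in a compact metric space *)

Section CompactMetric.
Import metricType_numDomainType.
Variables (R : realType) (X : metricType R).
Implicit Types (x y z : X) (A B : set X) (e r : R).
Local Notation d := (@mdist R X).

Lemma closure_mdistP A x :
  closure A x <-> forall e, 0 < e -> exists2 y, A y & d x y < e.
Proof.
split=> [Ax e e0|Ax B].
  have /Ax [y [Ay xy]] : nbhs x (ball x e) by exact: nbhsx_ballx.
  by exists y => //; move: xy; rewrite ballEmdist.
by rewrite -filter_from_mdist_nbhs => -[e e0 Be]; have [y Ay /Be] := Ax _ e0; exists y.
Qed.

Lemma open_mdistP A : open A <->
  forall x, A x -> exists2 e, 0 < e & forall y, d x y < e -> A y.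
Proof.
split=> [oA x Ax|oA].
  have : nbhs x A by exact: open_nbhs_nbhs.
  by rewrite -filter_from_mdist_nbhs.
rewrite openE => x /oA [e e0 Ae]; rewrite /interior -filter_from_mdist_nbhs.
by exists e.
Qed.

Lemma open_mdist_lt x r : open [set y | d x y < r].
Proof.
apply/open_mdistP => y /= xy; exists (r - d x y); first by rewrite subr_gt0.
by move=> z yz /=; have := metric_triangle x y z; lra.
Qed.

Lemma mdist_limit_le (h : X -> X) x y c : continuous h ->
  (forall e, 0 < e -> exists x' y', [/\ d x x' < e, d y y' < e & d (h x') (h y') <= c]) ->
  d (h x) (h y) <= c.
Proof.
move=> hc H; apply/ler_addgt0Pl => e e0.
have hcont z : exists2 r, 0 < r & forall z', d z z' < r -> d (h z) (h z') < e / 2.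
  have := hc z; move=> /cvgrPdist_lt /(_ (e / 2)); rewrite divr_gt0 // => /(_ isT).
  by move=> /nbhs_mdistP.
have [r r0 Hr] := hcont x; have [s s0 Hs] := hcont y.
have [|x' [y' [xx yy]]] := H (Num.min r s); first by rewrite lt_min r0.
move: xx yy; rewrite !lt_min => /andP[/Hr xx _] /andP[_ /Hs yy].
have := metric_triangle (h x) (h x') (h y); have := metric_triangle (h x') (h y') (h y).
have := metric_sym (h y) (h y'); lra.
Qed.

Lemma mdist_limit_le_cst (h : X -> X) x z c : continuous h ->
  (forall e, 0 < e -> exists2 x', d x x' < e & d (h x') z <= c) -> d (h x) z <= c.
Proof.
move=> hc H; apply/ler_addgt0Pl => e e0.
have /cvgrPdist_lt /(_ _ e0) /nbhs_mdistP [r /= r0 Hr] := hc x.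
have [x' /Hr] := H r r0; have := metric_triangle (h x) (h x') z; lra.
Qed.

Lemma nat_inv_lt e : 0 < e -> exists N : nat, forall n, (N <= n)%N -> n.+1%:R^-1 < e.
Proof.
move=> e0; have [N _ H] := near_infty_natSinv_lt (PosNum e0).
by exists N => n; exact: H.
Qed.

Hypothesis Xc : compact [set: X].

(** A single ultrafilter serves all sequences, so that several sequences, or all
    the selections from a sequence of sets, have limits along the same indices. *)
Lemma ultralimit : exists U : set_system nat,
  [/\ ProperFilter U, (forall N, \forall n \near U, (N <= n)%N) &
      forall u : nat -> X, exists l, forall e, 0 < e -> \forall n \near U, d l (u n) < e].
Proof.
have [U [UU sU]] := ultraFilterLemma eventually_filter.
have PU : ProperFilter U by exact: ultra_proper.
exists U; split=> // [N|u]; first by apply: sU; exact: nbhs_infty_ge.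
have UuU : UltraFilter (u @ U).
  apply: (@Build_UltraFilter _ _ (fmap_proper_filter u PU)) => G PG sG.
  apply/seteqP; split=> // A GA.
  have [//|UA] := in_ultra_setVsetC (u @^-1` A) UU.
  have : G (~` A) by apply: sG.
  by move=> /(filterI GA); rewrite setICr => /filter_ex [].
move: Xc; rewrite compact_ultra => /(_ _ UuU) [|l [_ ul]]; first exact: filterT.
by exists l => e e0; have /cvgrPdist_lt /(_ _ e0) := ul.
Qed.

Lemma cluster_point (u : nat -> X) :
  exists l, forall e N, 0 < e -> exists2 n, (N <= n)%N & d l (u n) < e.
Proof.
have [U [PU Uoo Ul]] := ultralimit; have [l ul] := Ul u; exists l => e N e0.
by have [n []] := filter_ex (filterI (ul _ e0) (Uoo N)); exists n.
Qed.

Lemma uniform_continuity (h : X -> X) : continuous h ->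
  forall e, 0 < e -> exists2 r, 0 < r & forall x y, d x y < r -> d (h x) (h y) < e.
Proof.
move=> hc e e0; apply: contrapT => /forall2NP H.
have {}H (n : nat) : exists p : X * X, d p.1 p.2 < n.+1%:R^-1 /\ e <= d (h p.1) (h p.2).
  have [|/existsNP[x /existsNP[y /not_implyP[xy /negP]]]] := H n.+1%:R^-1.
    by rewrite invr_gt0 ltr0n.
  by rewrite -leNgt => ?; exists (x, y).
have [p Hp] := choice H.
have [U [PU Uoo Ul]] := ultralimit; have [l ul] := Ul (fun n => (p n).1).
have := hc l; move=> /cvgrPdist_lt /(_ (e / 2)); rewrite divr_gt0 // => /(_ isT).
move=> /nbhs_mdistP [r /= r0 Hr].
have [N HN] := @nat_inv_lt (r / 2) (divr_gt0 r0 (ltr0n _ 2)).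
have [n [lpn Nn]] := filter_ex (filterI (ul (r / 2) (divr_gt0 r0 (ltr0n _ 2))) (Uoo N)).
have [pn epn] := Hp n; have {}pn := lt_trans pn (HN n Nn).
have tri := metric_triangle l (p n).1 (p n).2.
have /Hr : d l (p n).1 < r by rewrite /= in lpn; lra.
have /Hr : d l (p n).2 < r by rewrite /= in lpn; lra.
have := metric_triangle (h (p n).1) (h l) (h (p n).2).
have := metric_sym (h (p n).1) (h l); rewrite /=; lra.
Qed.

Lemma uniform_continuity_iter (h : X -> X) n : continuous h ->
  forall e, 0 < e -> exists2 r, 0 < r &
    forall x y, d x y < r -> forall i, (i <= n)%N -> d (iter i h x) (iter i h y) < e.
Proof.
move=> hc e e0; elim: n => [|n [r r0 Hr]].
  by exists e => // x y xy i; rewrite leqn0 => /eqP ->.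
have [s s0 Hs] := uniform_continuity (@iter_continuous _ _ n.+1 hc) e0.
exists (Num.min r s); first by rewrite lt_min r0.
move=> x y; rewrite lt_min => /andP[xyr xys] i; rewrite leq_eqVlt => /orP[/eqP ->|].
  exact: Hs.
exact: Hr.
Qed.

(** A gap in the limit would have to be crossed by almost all the sets, and
    limits of crossing points would be limit points lying in the gap. *)
Lemma ultralimit_connected (U : set_system nat) (B : nat -> set X) :
  ProperFilter U ->
  (forall N, \forall n \near U, (N <= n)%N) ->
  (forall u : nat -> X, exists l, forall e, 0 < e -> \forall n \near U, d l (u n) < e) ->
  (forall n, connected (B n)) ->
  connected [set z | forall e, 0 < e -> \forall n \near U, exists2 p, B n p & d z p < e].
Proof.
move=> PU Uoo Ul Bc; set L := [set z | _].
apply/connectedP => E [E0 LE [sE1 sE2]].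
have LEb b : E b `<=` L by move=> z; rewrite LE; case: b; [right|left].
have Lcl z : closure L z -> L z.
  move=> /closure_mdistP Lz e e0.
  have [y Ly zy] := Lz _ (divr_gt0 e0 (ltr0n _ 2)).
  apply: filterS (Ly _ (divr_gt0 e0 (ltr0n _ 2))) => n [p Bp yp]; exists p => //.
  have := metric_triangle z y p; lra.
(* the two pieces are at positive distance, the limit set being closed *)
have [r r0 Hr] : exists2 r, 0 < r & forall a b, E false a -> E true b -> r <= d a b.
  apply: contrapT => /forall2NP H.
  have {}H (n : nat) : exists p : X * X,
      [/\ E false p.1, E true p.2 & d p.1 p.2 < n.+1%:R^-1].
    have [|/existsNP[x /existsNP[y /not_implyP[Ex /not_implyP[Ey /negP]]]]] := H n.+1%:R^-1.
      by rewrite invr_gt0 ltr0n.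
    by rewrite -ltNge => ?; exists (x, y).
  have [p Hp] := choice H; have [l ul] := Ul (fun n => (p n).1).
  have cl0 : closure (E false) l.
    apply/closure_mdistP => e e0; have [n pn] := filter_ex (ul _ e0).
    by exists (p n).1 => //; have [] := Hp n.
  have cl1 : closure (E true) l.
    apply/closure_mdistP => e e0; have e20 : 0 < e / 2 by rewrite divr_gt0.
    have [N HN] := nat_inv_lt e20.
    have [n [pn Nn]] := filter_ex (filterI (ul _ e20) (Uoo N)).
    exists (p n).2; first by have [] := Hp n.
    have [_ _ /lt_trans/(_ (HN n Nn))] := Hp n; have := metric_triangle l (p n).1 (p n).2.
    rewrite /= in pn; lra.
  have : L l by apply: Lcl; apply: closureS cl0.
  rewrite LE => -[El|El].
    by have : (E false `&` closure (E true)) l by []; rewrite sE2.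
  by have : (closure (E false) `&` E true) l by []; rewrite sE1.
pose V b := [set x | exists2 a, E b a & d a x < r / 3].
have r3 : 0 < r / 3 by rewrite divr_gt0.
have Vsep : separated (V false) (V true).
  split; apply/seteqP; split=> // x [].
    move=> /closure_mdistP /(_ _ r3) [y [a Ea ay] xy] [b Eb bx].
    have := Hr _ _ Ea Eb; have := metric_triangle a y b; have := metric_triangle y x b.
    have := metric_sym x y; have := metric_sym x b; lra.
  move=> [a Ea ax] /closure_mdistP /(_ _ r3) [y [b Eb biy] xy].
  have := Hr _ _ Ea Eb; have := metric_triangle a x b; have := metric_triangle x y b.
  have := metric_sym b y; lra.
have Vdis x : V false x -> V true x -> False.
  move=> Vx Vx'; have := separated_disjoint Vsep; rewrite predeqE => /(_ x) [+ _].
  by apply.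
have meet b : \forall n \near U, exists2 p, B n p & V b p.
  have [a Ea] := E0 b; apply: filterS (LEb _ _ Ea _ r3) => n [p Bp ap].
  by exists p => //; exists a.
have out : \forall n \near U, exists p, [/\ B n p, ~ V false p & ~ V true p].
  apply: filterS (filterI (meet false) (meet true)) => n [[p Bp Vp] [q Bq Vq]].
  apply: contrapT => /forallNP H.
  have BV : B n `<=` V false `|` V true.
    by move=> x Bx; apply: contrapT => /not_orP[? ?]; apply: (H x).
  have [BV'|BV'] := connected_subset Vsep BV (Bc n).
    exact: (Vdis q (BV' _ Bq) Vq).
  exact: (Vdis p Vp (BV' _ Bp)).
have [a0 _] := E0 true.
have pick n : exists q, (exists q', [/\ B n q', ~ V false q' & ~ V true q']) ->
    [/\ B n q, ~ V false q & ~ V true q].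
  have [[q Bq]|nex] := pselect (exists q, [/\ B n q, ~ V false q & ~ V true q]).
    by exists q.
  by exists a0.
have [p Hp] := choice pick.
have [l ul] := Ul p.
have Ll : L l.
  move=> e e0; apply: filterS (filterI (ul _ e0) out) => n [lp /Hp [Bp _ _]].
  by exists (p n).
have [n [lp /Hp [_ nV0 nV1]]] := filter_ex (filterI (ul _ r3) out).
by move: Ll; rewrite LE => -[El|El]; [apply: nV0|apply: nV1]; exists l.
Qed.

End CompactMetric.

(** * Uniform contraction and local products *)

Section Homeos.
Variables (R : realType) (X : metricType R).
Implicit Types (f : homeo X) (x y z : X) (A B : set X) (e c : R).
Local Notation d := (@mdist R X).

Definition homeo_inv f : homeo X :=
  Homeo (@hinvK _ f) (@hfunK _ f) (@hinv_continuous _ f) (@hfun_continuous _ f).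

Lemma cw_hyperbolic_inv f : cw_hyperbolic f -> cw_hyperbolic (homeo_inv f).
Proof.
move=> [[c c0 fc] flps]; split.
  by exists c => // x; have := fc x; rewrite setIC.
move=> e /flps [r r0 Hr]; exists r => // x y xy.
by have [|z [zy zx]] := Hr y x; [rewrite metric_sym|exists z].
Qed.

Definition stable_bounded (f : X -> X) c A :=
  forall n a b, A a -> A b -> d (iter n f a) (iter n f b) <= c.

Lemma stable_boundedS (f : X -> X) c c' A :
  c <= c' -> stable_bounded f c A -> stable_bounded f c' A.
Proof. by move=> cc fA n a b Aa Ab; apply: le_trans (fA _ _ _ Aa Ab) cc. Qed.

Lemma Ws_bounded f e x A : A `<=` Ws f e x -> stable_bounded f (2 * e) A.
Proof.
move=> AW n a b /AW /(_ n) xa /AW /(_ n) xb.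
have := metric_triangle (iter n f a) (iter n f x) (iter n f b).
have := metric_sym (iter n f a) (iter n f x); lra.
Qed.

Lemma Cs_bounded f e x : stable_bounded f (2 * e) (Cs f e x).
Proof. by apply: (@Ws_bounded _ _ x); exact: connected_component_sub. Qed.

Lemma Cu_bounded f e x : stable_bounded (hinv f) (2 * e) (Cu f e x).
Proof. exact: (@Cs_bounded (homeo_inv f)). Qed.

Lemma Ws_refl f e x : 0 < e -> Ws f e x x.
Proof. by move=> e0 n; rewrite mdistxx ltW. Qed.

Lemma Cs_refl f e x : 0 < e -> Cs f e x x.
Proof. by move=> e0; apply: connected_component_refl; exact: Ws_refl. Qed.

Lemma iter_hinvK f n x : iter n f (iter n (hinv f) x) = x.
Proof. exact: (iter_cancel n (@hinvK _ f)). Qed.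

Lemma iter_hfunK f n x : iter n (hinv f) (iter n f x) = x.
Proof. exact: (iter_cancel n (@hfunK _ f)). Qed.

Lemma connected_iter (h : X -> X) n A :
  continuous h -> connected A -> connected (iter n h @` A).
Proof.
move=> hc Ac; apply: connected_continuous_connected => //.
by apply: continuous_subspaceT; exact: iter_continuous.
Qed.

Hypothesis Xc : compact [set: X].

(** Otherwise a limit of long iterates of connected sets, none of them small,
    would be connected, not reduced to a point, and bounded at all times in both
    directions: cw-expansiveness excludes it. *)
Lemma cw_expansive_contraction f : cw_expansive f -> exists2 c, 0 < c &
  forall g, 0 < g -> exists N : nat, forall n A, (N <= n)%N -> connected A ->
    stable_bounded f c A -> forall a b, A a -> A b ->
    d (iter n f a) (iter n f b) < g.
Proof.
move=> [c c0 fc]; exists c => // g g0; apply: contrapT => /forallNP H.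
have {}H (N : nat) : exists p : nat * set X * (X * X),
    [/\ (N <= p.1.1)%N, connected p.1.2 /\ stable_bounded f c p.1.2,
        p.1.2 p.2.1, p.1.2 p.2.2 &
        g <= d (iter p.1.1 f p.2.1) (iter p.1.1 f p.2.2)].
  have /existsNP [n /existsNP [A]] := H N.
  move=> /not_implyP[Nn /not_implyP[cA /not_implyP[sA /existsNP [a /existsNP [b]]]]].
  by move=> /not_implyP[Aa /not_implyP[Ab /negP]]; rewrite -leNgt => ?; exists (n, A, (a, b)).
have [p Hp] := choice H.
pose t N := (p N).1.1; pose A N := (p N).1.2.
have [U [PU Uoo Ul]] := ultralimit Xc.
have Bc N : connected (iter (t N) f @` A N).
  by have [_ [cA _] _ _ _] := Hp N; apply: connected_iter => //; exact: hfun_continuous.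
have Lc := ultralimit_connected PU Uoo Ul Bc; set L := [set z | _] in Lc.
have Llim (u : nat -> X) l : (forall N, A N (u N)) ->
    (forall e, 0 < e -> \forall n \near U, d l (iter (t n) f (u n)) < e) -> L l.
  move=> Au ul e e0; apply: filterS (ul e e0) => n ln.
  by exists (iter (t n) f (u n)) => //; exists (u n).
have [a la] := Ul (fun N => iter (t N) f (p N).2.1).
have [b lb] := Ul (fun N => iter (t N) f (p N).2.2).
have La : L a by apply: Llim la => N; have [] := Hp N.
have Lb : L b by apply: Llim lb => N; have [] := Hp N.
have LW : L `<=` Wu f c a `&` Ws f c a.
  (* both bounds are limits of bounds at the times [t n - i] and [t n + i] *)
  move=> z Lz; split=> i; apply: mdist_limit_le.
  - by apply: iter_continuous; exact: hinv_continuous.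
  - move=> e e0; have [n] := filter_ex (filterI (Uoo i) (filterI (La _ e0) (Lz _ e0))).
    move=> [/= it [[x' [u Au <-] xx] [y' [v Av <-] yy]]].
    exists (iter (t n) f u), (iter (t n) f v); split=> //.
    have [Nn [_ sA] _ _ _] := Hp n.
    have tE : t n = (i + (t n - i))%N by rewrite subnKC // (leq_trans it).
    by rewrite tE !iterD !iter_hfunK; exact: sA.
  - by apply: iter_continuous; exact: hfun_continuous.
  - move=> e e0; have [n] := filter_ex (filterI (La _ e0) (Lz _ e0)).
    move=> [[x' [u Au <-] xx] [y' [v Av <-] yy]].
    exists (iter (t n) f u), (iter (t n) f v); split=> //.
    by have [_ [_ sA] _ _ _] := Hp n; rewrite -!iterD; exact: sA.
have ab : a = b.
  have := fc a a (LW _ La); rewrite predeqE => /(_ b) [+ _] => /(_ _)/esym; apply.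
  exact: (connected_component_max La LW Lc).
have g2 : 0 < g / 2 by rewrite divr_gt0.
have [n [an bn]] := filter_ex (filterI (la _ g2) (lb _ g2)).
have [_ _ _ _] := Hp n; rewrite -ab in bn.
have := metric_triangle (iter (t n) f (p n).2.1) a (iter (t n) f (p n).2.2).
have := metric_sym (iter (t n) f (p n).2.1) a; move: an bn; rewrite /= /t; lra.
Qed.

(** The point given by the local product structure lies on stable and unstable
    continua, which are contracted: it is asymptotic to both points, at a rate
    that does not depend on them. *)
Lemma cw_local_product f : cw_hyperbolic f -> forall e, 0 < e ->
  exists r (rate : R -> nat), 0 < r /\ forall x y, d x y < r -> exists z,
    [/\ Ws f e x z, Wu f e y z,
        forall g n, 0 < g -> (rate g <= n)%N -> d (iter n f x) (iter n f z) < g &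
        forall g n, 0 < g -> (rate g <= n)%N ->
          d (iter n (hinv f) y) (iter n (hinv f) z) < g].
Proof.
move=> fcw e e0; have [fe flps] := fcw.
have [c c0 Hc] := cw_expansive_contraction fe.
have [c' c'0 Hc'] := cw_expansive_contraction (cw_hyperbolic_inv fcw).1.
pose a := Num.min e (Num.min (c / 2) (c' / 2)).
have a0 : 0 < a by rewrite !lt_min e0 !divr_gt0.
have [ae ac ac'] : [/\ a <= e, 2 * a <= c & 2 * a <= c'].
  have : a <= a by []; rewrite {2}/a !le_min => /and3P[? ? ?]; split=> //; lra.
have [r r0 Hr] := flps a a0.
have /choice [rate Hrate] (g : R) : exists N : nat, 0 < g ->
    forall n x y z, (N <= n)%N -> Cs f a x z -> Cu f a y z ->
    d (iter n f x) (iter n f z) < g /\ d (iter n (hinv f) y) (iter n (hinv f) z) < g.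
  case: (ltP 0 g) => g0; last by exists 0%N.
  have [N HN] := Hc g g0; have [N' HN'] := Hc' g g0; exists (maxn N N') => _ n x y z.
  rewrite geq_max => /andP[Nn N'n] xz yz; split.
    apply: (HN n (Cs f a x)) => //; first exact: component_connected.
      exact: stable_boundedS ac (@Cs_bounded _ _ _).
    exact: Cs_refl.
  apply: (HN' n (Cu f a y)) => //; first exact: component_connected.
    exact: stable_boundedS ac' (@Cu_bounded _ _ _).
  exact: (@Cs_refl (homeo_inv f)).
exists r, rate; split=> // x y /Hr [z [xz yz]]; exists z; split.
- by move=> n; apply: le_trans ae; exact: (connected_component_sub xz).
- by move=> n; apply: le_trans ae; exact: (connected_component_sub yz).
- by move=> g n g0 rn; have [] := Hrate g g0 n x y z rn xz yz.
- by move=> g n g0 rn; have [] := Hrate g g0 n x y z rn xz yz.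
Qed.

End Homeos.

(** * Shadowing *)

Section Shadowing.
Variables (R : realType) (X : metricType R).
Implicit Types (f : homeo X) (x y z : X) (A B : set X) (e c : R).
Local Notation d := (@mdist R X).

Lemma iter_hinv_sub f n i x :
  (i <= n)%N -> iter i f (iter n (hinv f) x) = iter (n - i) (hinv f) x.
Proof. by move=> ni; rewrite -{1}(subnKC ni) iterD iter_hinvK. Qed.

Hypothesis Xc : compact [set: X].

Lemma pseudo_orbit_iter f N e : 0 < e -> exists2 r, 0 < r &
  forall x : nat -> X, (forall k, d (f (x k)) (x k.+1) <= r) ->
  forall k i, (i <= N)%N -> d (iter i f (x k)) (x (k + i)%N) < e.
Proof.
elim: N e => [|N IHN] e e0.
  by exists e => // x _ k i; rewrite leqn0 => /eqP ->; rewrite addn0 mdistxx.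
have [s s0 Hs] := uniform_continuity Xc (@hfun_continuous _ f) (divr_gt0 e0 (ltr0n _ 2)).
have [|r r0 Hr] := IHN (Num.min e s); first by rewrite lt_min e0.
exists (Num.min r (e / 2)); first by rewrite lt_min r0 divr_gt0.
move=> x xP k i; have {}xP j : d (f (x j)) (x j.+1) <= r /\ d (f (x j)) (x j.+1) <= e / 2.
  by apply/andP; rewrite -le_min.
have {}Hr := Hr x (fun j => (xP j).1); case: i => [|i] iN.
  by rewrite addn0 mdistxx.
have := Hr k i iN; rewrite lt_min => /andP[_ /Hs].
have := (xP (k + i)%N).2; rewrite addnS /=.
have := metric_triangle (f (iter i f (x k))) (f (x (k + i)%N)) (x (k + i).+1); lra.
Qed.

(** The pseudo-orbit is read every [M] steps, [M] being large enough for local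
    continua to be contracted.  The points [y j] jump from the local unstable
    continuum of the image of [y j.-1] to the local stable continuum of the
    pseudo-orbit.  Pulled back to a given time, the successive jumps lie on
    unstable continua that chain up to a connected set.  The sizes of the jumps
    need not be summable; the union stays small because each pull-back by [M]
    steps brings it back below the bound assumed for the part already built. *)
Theorem shadowing f : cw_hyperbolic f -> forall e, 0 < e -> exists2 r, 0 < r &
  forall x : nat -> X, (forall k, d (f (x k)) (x k.+1) <= r) ->
  exists w, forall k, d (iter k f w) (x k) <= e.
Proof.
move=> fcw e e0; have [fe flps] := fcw.
have [c c0 Hc] := cw_expansive_contraction Xc fe.
have [c' c'0 Hc'] := cw_expansive_contraction Xc (cw_hyperbolic_inv fcw).1.
(* the error is at most [a] from the pseudo-orbit to the orbit of one of its
   points, [a] from there to the orbit of [y j], and [3 a] along the union *)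
pose a := Num.min (e / 5) (Num.min (c / 2) (c' / 3)).
have a0 : 0 < a by rewrite !lt_min !divr_gt0.
have [ae ac ac'] : [/\ 5 * a <= e, 2 * a <= c & 3 * a <= c'].
  have : a <= a by []; rewrite {2}/a !le_min => /and3P[? ? ?]; split; lra.
have [r1 r10 Hr1] := flps a a0.
have r120 : 0 < r1 / 2 by rewrite divr_gt0.
have [N HN] := Hc (r1 / 2) r120; have [N' HN'] := Hc' a a0.
pose M := (maxn N N').+1.
have [NM N'M] : (N <= M)%N /\ (N' <= M)%N by rewrite /M; lia.
have [|r r0 Hr] := @pseudo_orbit_iter f M (Num.min a (r1 / 2)).
  by rewrite lt_min a0.
exists r => // x xP; have {}Hr k i : (i <= M)%N ->
    d (iter i f (x k)) (x (k + i)%N) < a /\ d (iter i f (x k)) (x (k + i)%N) < r1 / 2.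
  by move=> iM; apply/andP; rewrite -lt_min; exact: Hr.
have step (p : nat * X) : exists v, Cs f a (x (p.1 * M)%N) p.2 ->
    Cs f a (x (p.1.+1 * M)%N) v /\ Cu f a (iter M f p.2) v.
  have [Cp|nCp] := pselect (Cs f a (x (p.1 * M)%N) p.2); last by exists p.2.
  have [|v [? ?]] := Hr1 (x (p.1.+1 * M)%N) (iter M f p.2); last by exists v.
  have [_] := Hr (p.1 * M)%N M (leqnn _).
  have : d (iter M f (x (p.1 * M)%N)) (iter M f p.2) < r1 / 2.
    apply: (HN M (Cs f a (x (p.1 * M)%N))) => //; first exact: component_connected.
      exact: stable_boundedS ac (@Cs_bounded _ _ _ _ _).
    exact: Cs_refl.
  rewrite -mulSnr.
  have := metric_triangle (x (p.1.+1 * M)%N) (iter M f (x (p.1 * M)%N)) (iter M f p.2).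
  have := metric_sym (x (p.1.+1 * M)%N) (iter M f (x (p.1 * M)%N)); lra.
have [s Hs] := choice step.
pose y j := iteri j (fun i u => s (i, u)) (x 0%N).
have ys j : Cs f a (x (j * M)%N) (y j).
  by elim: j => [|j /(Hs (j, _)) [] //]; exact: Cs_refl.
have yu j : Cu f a (iter M f (y j)) (y j.+1) by have [] := Hs (j, _) (ys j).
have link k j : exists A, [/\ connected A, A (y j) /\ A (iter (k * M) (hinv f) (y (j + k)%N)),
    stable_bounded (hinv f) a A &
    forall i p q, (i <= M)%N -> A p -> A q -> d (iter i f p) (iter i f q) <= 3 * a].
  elim: k j => [|k IHk] j.
    exists [set y j]; rewrite addn0 mul0n; split=> //; first exact: connected1.
      by move=> n p q -> ->; rewrite mdistxx ltW.
    by move=> i p q _ -> ->; rewrite mdistxx; lra.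
  have [A [cA [Ay Aw] sA _]] := IHk j.+1.
  pose C := Cu f a (iter M f (y j)).
  have sC : stable_bounded (hinv f) (2 * a) C by exact: Cu_bounded.
  have sG : stable_bounded (hinv f) (3 * a) (C `|` A).
    move=> n p q [Cp|Ap] [Cq|Aq].
    - by have := sC n _ _ Cp Cq; lra.
    - have := sC n _ _ Cp (yu j); have := sA n _ _ Ay Aq.
      have := metric_triangle (iter n (hinv f) p) (iter n (hinv f) (y j.+1)) (iter n (hinv f) q).
      lra.
    - have := sC n _ _ (yu j) Cq; have := sA n _ _ Ap Ay.
      have := metric_triangle (iter n (hinv f) p) (iter n (hinv f) (y j.+1)) (iter n (hinv f) q).
      lra.
    - by have := sA n _ _ Ap Aq; lra.
  have cG : connected (C `|` A).
    apply: connectedU => //; last exact: component_connected.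
    by exists (y j.+1); split; first exact: yu.
  exists (iter M (hinv f) @` (C `|` A)); split.
  - by apply: connected_iter => //; exact: hinv_continuous.
  - split.
      exists (iter M f (y j)); last exact: iter_hfunK.
      by left; apply: (@Cs_refl _ _ (homeo_inv f)).
    exists (iter (k * M) (hinv f) (y (j.+1 + k)%N)); first by right.
    by rewrite mulSn iterD addSnnS.
  - move=> n _ _ [p Gp <-] [q Gq <-]; rewrite -!iterD ltW //.
    apply: (HN' _ (C `|` A)) => //; first by rewrite (leq_trans N'M) ?leq_addl.
    exact: stable_boundedS sG.
  - by move=> i _ _ iM [p Gp <-] [q Gq <-]; rewrite !iter_hinv_sub //; exact: sG.
have [w Hw] := cluster_point Xc (fun k => iter (k * M) (hinv f) (y k)).
exists w => t; apply: mdist_limit_le_cst.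
  by apply: iter_continuous; exact: hfun_continuous.
move=> g g0; have [k jk wk] := Hw g (t %/ M)%N g0.
exists (iter (k * M) (hinv f) (y k)) => //.
have iM : (t %% M <= M)%N by rewrite ltnW // ltn_mod.
have [A [_ [Ay Aw] _ sA]] := link (k - t %/ M)%N (t %/ M)%N.
have := sA _ _ _ iM Aw Ay; rewrite subnKC //.
have [+ _] := Hr ((t %/ M) * M)%N _ iM; rewrite -divn_eq.
have : d (iter (t %% M) f (x (t %/ M * M)%N)) (iter (t %% M) f (y (t %/ M)%N)) <= a.
  by have := connected_component_sub (ys (t %/ M)%N).
have -> : iter t f (iter (k * M) (hinv f) (y k)) =
    iter (t %% M) f (iter ((k - t %/ M) * M) (hinv f) (y k)).
  rewrite {1}(divn_eq t M) addnC iterD; congr iter.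
  by rewrite iter_hinv_sub ?leq_mul2r ?jk ?orbT // -mulnBl.
set p := iter _ f (iter _ _ _); set q := iter _ f (y _); set u := iter _ f (x _).
have := metric_triangle p q (x t); have := metric_triangle q u (x t).
have := metric_sym q u; lra.
Qed.

End Shadowing.

(** * Integer iterates, chains and chain recurrent classes *)

Section IntegerIterates.
Variables (X : topologicalType) (f : homeo X).
Implicit Types (x : X) (i j : int).

Lemma hiterzS i x : hiterz f (i + 1) x = f (hiterz f i x).
Proof.
case: i => [n|[|n]]; first by rewrite -PoszD addn1.
  by rewrite /= hinvK.
have -> : Negz n.+1 + 1 = Negz n by rewrite !NegzE; lia.
by rewrite /= hinvK.
Qed.

Lemma hiterz_pred i x : hiterz f (i - 1) x = hinv f (hiterz f i x).
Proof. by rewrite -{2}(subrK 1 i) hiterzS hfunK. Qed.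

Lemma hiterzD i j x : hiterz f (i + j) x = hiterz f i (hiterz f j x).
Proof.
elim/int_ind: i => [|n IHn|n IHn]; first by rewrite add0r.
  by rewrite -addn1 PoszD addrAC !hiterzS IHn.
by rewrite -addn1 PoszD opprD addrAC !hiterz_pred IHn.
Qed.

Lemma hiterzN n x : hiterz f (- n%:Z) x = iter n (hinv f) x.
Proof. by case: n => [|n] //; rewrite -NegzE. Qed.

Lemma hiterz_continuous i : continuous (hiterz f i).
Proof.
by case: i => n; apply: iter_continuous; [exact: hfun_continuous|exact: hinv_continuous].
Qed.

End IntegerIterates.

Section Chains.
Variables (R : realType) (X : metricType R).
Implicit Types (f : homeo X) (x y z : X) (A C : set X) (e r : R) (k l : nat).
Local Notation d := (@mdist R X).

Definition chain f e k x y := exists u : nat -> X,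
  [/\ u 0%N = x, u k = y & forall i, (i < k)%N -> d (f (u i)) (u i.+1) <= e].

Definition reach f x y := forall e, 0 < e -> eps_chain f e x y.

Lemma eps_chainP f e x y : eps_chain f e x y <-> exists2 k, (0 < k)%N & chain f e k x y.
Proof.
split=> [[k [u [k0 ux uy uP]]]|[k k0 [u [ux uy uP]]]]; exists k => //; last by exists u.
by exists u.
Qed.

Lemma chain_cat f e k l x y z :
  chain f e k x y -> chain f e l y z -> chain f e (k + l) x z.
Proof.
move=> [u [ux uy uP]] [v [vy vz vP]].
exists (fun i => if (i < k)%N then u i else v (i - k)%N); split.
- by case: k uy {uP} => [uy|k _] //; rewrite subn0 vy -uy ux.
- by rewrite ltnNge leq_addr /= addKn.
- move=> i ikl; case: ltnP => ik.
    case: ltnP => ik1; first exact: uP.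
    have -> : (i.+1 - k = 0)%N by lia.
    have ki : i.+1 = k by lia.
    by rewrite vy -uy -ki; exact: uP.
  rewrite ltnNge (leq_trans ik) //= subSn //; apply: vP; lia.
Qed.

Lemma chain1 f e x y : d (f x) y <= e -> chain f e 1 x y.
Proof. by move=> xy; exists (fun i => if i is 0%N then x else y); split=> // -[]. Qed.

Lemma chain_orbit f e k x : 0 <= e -> chain f e k x (iter k f x).
Proof. by move=> e0; exists (fun i => iter i f x); split=> // i _; rewrite mdistxx. Qed.

Lemma chainW f e e' k x y : e <= e' -> chain f e k x y -> chain f e' k x y.
Proof.
by move=> ee [u [ux uy uP]]; exists u; split=> // i /uP /le_trans; apply.
Qed.

Lemma chain_behead f e k x y :
  chain f e k.+1 x y -> exists2 z, d (f x) z <= e & chain f e k z y.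
Proof.
move=> [u [ux uy uP]]; exists (u 1%N); first by rewrite -ux; exact: (uP 0%N).
by exists (fun i => u i.+1); split=> // i; exact: (uP i.+1).
Qed.

Lemma chain_start f e e' k x x' y : 0 <= e' -> d (f x') (f x) <= e' ->
  chain f e k.+1 x y -> chain f (e + e') k.+1 x' y.
Proof.
move=> e'0 xx /chain_behead [z xz zy]; rewrite -add1n; apply: chain_cat.
  by apply: chain1; apply: le_trans (metric_triangle _ (f x) _) _; lra.
by apply: chainW zy; rewrite lerDl.
Qed.

Lemma chain_end f e e' k x y y' : 0 <= e' -> d y y' <= e' ->
  chain f e k.+1 x y -> chain f (e + e') k.+1 x y'.
Proof.
move=> e'0 yy [u [ux uy uP]].
exists (fun i => if i == k.+1 then y' else u i); split=> //; first by rewrite eqxx.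
move=> i ik; rewrite (ltn_eqF ik); case: eqP => [iE|_].
  have := uP _ ik; rewrite iE uy => h.
  by have := metric_triangle (f (u i)) y y'; lra.
by apply: le_trans (uP _ ik) _; rewrite lerDl.
Qed.

Lemma eps_chain_trans f e x y z :
  eps_chain f e x y -> eps_chain f e y z -> eps_chain f e x z.
Proof.
move=> /eps_chainP [k k0 xy] /eps_chainP [l l0 yz]; apply/eps_chainP.
by exists (k + l)%N; [rewrite addn_gt0 k0|exact: chain_cat xy yz].
Qed.

Lemma reach_trans f x y z : reach f x y -> reach f y z -> reach f x z.
Proof. by move=> xy yz e e0; exact: eps_chain_trans (xy e e0) (yz e e0). Qed.

Lemma reach_image f x : reach f x (f x).
Proof.
by move=> e e0; apply/eps_chainP; exists 1%N => //; apply: chain1; rewrite mdistxx ltW.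
Qed.

Hypothesis Xc : compact [set: X].

Lemma reach_closed f x y :
  (forall r, 0 < r -> exists x' y', [/\ d x x' < r, d y y' < r & reach f x' y']) ->
  reach f x y.
Proof.
move=> H e e0; have e3 : 0 < e / 3 by rewrite divr_gt0.
have [s s0 Hs] := uniform_continuity Xc (@hfun_continuous _ f) e3.
have [|x' [y' [xx yy /(_ _ e3)]]] := H (Num.min s (e / 3)); first by rewrite lt_min s0.
move: xx yy; rewrite !lt_min => /andP[/Hs xx _] /andP[_ yy].
move=> /eps_chainP [[//|k] k0 xy]; apply/eps_chainP; exists k.+1 => //.
have -> : e = e / 3 + e / 3 + e / 3 by lra.
apply: chain_end; [exact: ltW|by rewrite metric_sym; apply: ltW; exact: yy|].
apply: chain_start xy; exact: ltW.
Qed.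

Lemma reach_comm f (h : X -> X) x y : continuous h -> (forall z, f (h z) = h (f z)) ->
  reach f x y -> reach f (h x) (h y).
Proof.
move=> hc hf xy e e0; have [s s0 Hs] := uniform_continuity Xc hc e0.
have s20 : 0 < s / 2 by rewrite divr_gt0.
have [k [u [k0 ux uy uP]]] := xy _ s20; exists k, (h \o u); split=> //=.
- by rewrite ux.
- by rewrite uy.
- by move=> i /uP ui; rewrite hf; apply/ltW/Hs; lra.
Qed.

(** Going around a loop twice makes at least two jumps, so that the first point
    reached can be replaced by [f x]. *)
Lemma reach_back f x : chain_recurrent f x -> reach f (f x) x.
Proof.
move=> xx e e0; have e2 : 0 < e / 2 by rewrite divr_gt0.
have [s s0 Hs] := uniform_continuity Xc (@hfun_continuous _ f) e2.
have m0 : 0 < Num.min (s / 2) (e / 2) by rewrite lt_min !divr_gt0.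
have /eps_chainP [[//|k] _ c] := xx _ m0.
have := chain_cat c c; rewrite addSn addnS => /chain_behead [z xz zx].
have ms : Num.min (s / 2) (e / 2) <= s / 2 by rewrite ge_min lexx.
have me : Num.min (s / 2) (e / 2) <= e / 2 by rewrite ge_min lexx orbT.
apply/eps_chainP; exists (k + k).+1 => //; rewrite [e]splitr.
apply: chain_start; [exact: ltW| |exact: chainW zx].
by apply/ltW/Hs; lra.
Qed.

Lemma reach_hinv f x : chain_recurrent f x -> reach f x (hinv f x) /\ reach f (hinv f x) x.
Proof.
move=> xx; split; last by have := @reach_image f (hinv f x); rewrite hinvK.
rewrite -{1}(hinvK f x); apply: reach_back; apply: reach_comm xx.
  exact: hinv_continuous.
by move=> z; rewrite hinvK hfunK.
Qed.

Section Class.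
Variables (f : homeo X) (C : set X).
Hypothesis fC : chain_recurrent_class f C.

Lemma class_nonempty : C !=set0.
Proof. by have [x xx ->] := fC; exists x; split=> // e /xx. Qed.

Lemma class_reach x y : C x -> C y -> reach f x y.
Proof.
have [z zz ->] := fC => -[_ zx] [_ zy]; apply: (@reach_trans _ _ z) => e /[dup].
  by move=> /zx [].
by move=> /zy [].
Qed.

Lemma class_mem x y : C x -> reach f x y -> reach f y x -> C y.
Proof.
move=> Cx xy yx; have yy : chain_recurrent f y by exact: reach_trans yx xy.
have [z zz CE] := fC; move: (Cx); rewrite CE => -[_ zx]; split=> // e e0.
have [zxe xze] := zx e e0.
by split; [exact: eps_chain_trans zxe (xy e e0)|exact: eps_chain_trans (yx e e0) xze].
Qed.

Lemma class_closed x : (forall r, 0 < r -> exists2 y, C y & d x y < r) -> C x.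
Proof.
move=> Hx; have [y Cy _] := Hx 1 ltr01.
apply: (class_mem Cy); apply: reach_closed => r r0; have [z Cz xz] := Hx r r0.
  by exists y, z; rewrite mdistxx; split=> //; exact: class_reach.
by exists z, y; rewrite mdistxx; split=> //; exact: class_reach.
Qed.

Lemma class_compact : compact C.
Proof.
apply: (subclosed_compact _ Xc) => // x Cx.
by apply: class_closed => r r0; have /closure_mdistP := Cx; apply.
Qed.

Lemma class_image x : C x -> C (f x).
Proof.
move=> Cx; apply: (class_mem Cx); first exact: reach_image.
by apply: reach_back; exact: class_reach.
Qed.

Lemma class_hinv x : C x -> C (hinv f x).
Proof.
by move=> Cx; have [] := @reach_hinv f x (class_reach Cx Cx); exact: class_mem.
Qed.

Lemma class_hiterz i x : C x -> C (hiterz f i x).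
Proof.
move=> Cx; elim/int_ind: i => [|n IHn|n IHn] //.
  by rewrite -addn1 PoszD hiterzS; exact: class_image.
by rewrite -addn1 PoszD opprD hiterz_pred; exact: class_hinv.
Qed.

Lemma class_iter n x : C x -> C (iter n f x).
Proof. exact: (class_hiterz n%:Z). Qed.

End Class.

(** The chain follows the orbit of the local product point.  Its length is the
    one an orbit would have, so that it can be compared with orbits when lengths
    are counted modulo a period. *)
Lemma local_product_chain f : cw_hyperbolic f -> exists2 r, 0 < r &
  forall x y, d x y < r -> forall e, 0 < e ->
  exists2 k, (0 < k)%N & exists l, chain f e (k + l) (iter k (hinv f) y) (iter l f x).
Proof.
move=> fcw; have [r [N [r0 H]]] := cw_local_product Xc fcw ltr01.
exists r => // x y /H [z [_ _ xz yz]] e e0; exists (N e).+1 => //; exists (N e).+1.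
rewrite addSn addnS -addn1 -add1n -addnA; apply: (@chain_cat _ _ _ _ _ (iter (N e) (hinv f) z)).
  by apply: chain1; rewrite iterS hinvK ltW // yz.
apply: (@chain_cat _ _ _ _ _ (iter (N e) f z)).
  by rewrite -{2}(iter_hinvK f (N e) z) -iterD; apply: chain_orbit; exact: ltW.
by apply: chain1; rewrite -iterS metric_sym ltW // xz.
Qed.

(** Two close chain recurrent points are equivalent: the past of either one is
    linked to the future of the other one, and a chain recurrent point reaches,
    and is reached from, all the points of its orbit. *)
Lemma class_isolated f : cw_hyperbolic f -> exists2 r, 0 < r &
  forall C, chain_recurrent_class f C ->
  forall x y, C x -> chain_recurrent f y -> d x y < r -> C y.
Proof.
move=> fcw; have [r r0 H] := local_product_chain fcw; exists r => // C fC x y Cx yy xy.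
have reach_close a b : chain_recurrent f a -> chain_recurrent f b -> d a b < r -> reach f b a.
  move=> aa bb ab e e0; have [k k0 [l c]] := H a b ab e e0.
  have bk n : eps_chain f e b (iter n (hinv f) b).
    have : chain_recurrent f (iter n (hinv f) b) /\ reach f b (iter n (hinv f) b).
      elim: n => [|n [cr IHn]] //=; have [nS Sn] := reach_hinv cr.
      by split; [exact: reach_trans Sn nS|exact: reach_trans IHn nS].
    by case=> _; apply.
  have al n : eps_chain f e (iter n f a) a.
    have : chain_recurrent f (iter n f a) /\ reach f (iter n f a) a.
      elim: n => [|n [cr IHn]] //=; have Sn := reach_back cr.
      split; [apply: reach_trans Sn _; exact: reach_image|exact: reach_trans Sn IHn].
    by case=> _; apply.
  apply: eps_chain_trans (bk k) _; apply: eps_chain_trans (al l).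
  by apply/eps_chainP; exists (k + l)%N; first by rewrite addn_gt0 k0.
have xx : chain_recurrent f x := class_reach fC Cx Cx.
by apply: (class_mem fC Cx); apply: reach_close => //; rewrite metric_sym.
Qed.

End Chains.

(** * Shadowing inside a class *)

Section ClassShadowing.
Variables (R : realType) (X : metricType R).
Implicit Types (f : homeo X) (x y z : X) (A C : set X) (e r : R) (k l : nat).
Local Notation d := (@mdist R X).
Hypothesis Xc : compact [set: X].

(** By compactness, infinitely many classes would come arbitrarily close to each
    other, whereas [class_isolated] keeps them at a uniform distance. *)
Lemma finite_classes f : cw_hyperbolic f ->
  finite_set [set C : set X | chain_recurrent_class f C].
Proof.
move=> fcw; have [r r0 Hr] := class_isolated Xc fcw.
apply: contrapT => /infiniteP /pcard_leP /unsquash u.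
have Hu n : chain_recurrent_class f (u n) by have := @funS _ _ _ _ u n I.
have [p Hp] := choice (fun n => class_nonempty (Hu n)).
have [l ul] := cluster_point Xc p; have r2 : 0 < r / 2 by rewrite divr_gt0.
have [n _ ln] := ul (r / 2) 0%N r2; have [m nm lm] := ul (r / 2) n.+1 r2.
have nm_eq : u n = u m.
  have Cm : u n (p m).
    apply: (Hr _ (Hu n) (p n)) => //; first exact: (class_reach (Hu m)).
    have := metric_triangle (p n) l (p m); have := metric_sym (p n) l; lra.
  apply/seteqP; split=> x Cx.
    by apply: (class_mem (Hu m) (Hp m)); apply: (class_reach (Hu n)).
  by apply: (class_mem (Hu n) Cm); apply: (class_reach (Hu m)).
have := @inj _ _ _ u n m; rewrite !inE => /(_ I I nm_eq) nE; move: nm; lia.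
Qed.

(** Close the chain up to a periodic pseudo-orbit, shadow the latter, and take
    a limit of the shadowing point along the period: the limit still shadows
    and is chain recurrent, and it is close to the class, hence in it. *)
Lemma class_shadowing f C : cw_hyperbolic f -> chain_recurrent_class f C ->
  forall e, 0 < e -> exists2 r, 0 < r & forall (u : nat -> X) k,
  C (u 0%N) -> C (u k) -> (forall i, (i < k)%N -> d (f (u i)) (u i.+1) <= r) ->
  exists2 w, C w & forall i, (i <= k)%N -> d (iter i f w) (u i) <= e.
Proof.
move=> fcw fC e e0; have [r0 r00 Cr0] := class_isolated Xc fcw.
have [|r r_gt0 Hr] := shadowing Xc fcw (e := Num.min e (r0 / 2)).
  by rewrite lt_min e0 divr_gt0.
exists r => // u k Cu0 Cuk uP.
have [l [v [l0 v0 vl vP]]] := class_reach fC Cuk Cu0 r_gt0.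
pose P := (k + l)%N; have P0 : (0 < P)%N by rewrite /P; lia.
pose W i := if (i < k)%N then u i else v (i - k)%N.
have W0 : W 0%N = u 0%N by rewrite /W; case: ltnP => //; case: (k) v0.
have WP : W P = u 0%N by rewrite /W ltnNge leq_addr /= addKn.
have Wk i : (i <= k)%N -> W i = u i.
  rewrite /W leq_eqVlt => /predU1P[->|-> //]; by rewrite ltnn subnn v0.
have WS i : (i < P)%N -> d (f (W i)) (W i.+1) <= r.
  move=> iP; have [ik|ki] := ltnP i k; first by rewrite !Wk ?(ltnW ik) //; exact: uP.
  rewrite /W !ltnNge ki (leq_trans ki) //= subSn //; apply: vP; rewrite /P in iP; lia.
have [|w0 Hw0] := Hr (fun i => W (i %% P)%N).
  move=> i; have := WS (i %% P)%N (ltn_pmod _ P0).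
  have [iP|iP] := eqVneq (i %% P).+1 P.
    by rewrite iP WP -W0 -addn1 -(modnDml i) addn1 iP modnn.
  by rewrite -(addn1 i) -(modnDml i) addn1 (@modn_small (i %% P).+1) // ltn_neqAle iP ltn_pmod.
have [w Hw] := cluster_point Xc (fun j => iter (j * P) f w0).
have {Hw0} Hw1 i : d (iter i f w) (W (i %% P)%N) <= Num.min e (r0 / 2).
  apply: mdist_limit_le_cst; first by apply: iter_continuous; exact: hfun_continuous.
  move=> g g0; have [j _ wj] := Hw g 0%N g0; exists (iter (j * P) f w0) => //.
  by have := Hw0 (i + j * P)%N; rewrite iterD addnC modnMDl.
have {}Hw1 i : d (iter i f w) (W (i %% P)%N) <= e /\ d (iter i f w) (W (i %% P)%N) <= r0 / 2.
  by apply/andP; rewrite -le_min.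
exists w.
  apply: (Cr0 _ fC (u 0%N)) => //; last first.
    by have [_] := Hw1 0%N; rewrite mod0n W0 metric_sym => /le_lt_trans; apply; lra.
  move=> g g0; have g2 : 0 < g / 2 by rewrite divr_gt0.
  have [s s0 Hs] := uniform_continuity Xc (@hfun_continuous _ f) g2.
  have [j _ wj] := Hw s 0%N s0; have [j' jj' wj'] := Hw (g / 2) j.+1 g2.
  apply/eps_chainP; pose n := (j' * P - (j * P).+1)%N; exists n.+1 => //.
  have nE : (n + (j * P).+1)%N = (j' * P)%N.
    by rewrite subnK // (leq_trans _ (leq_mul jj' (leqnn P))) // mulSn; lia.
  rewrite [g]splitr; apply: chain_end; [exact: ltW|by rewrite metric_sym ltW //; exact: wj'|].
  rewrite -(add1n n); apply: (chain_cat (y := iter (j * P).+1 f w0)).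
    by apply: chain1; apply/ltW/Hs.
  by rewrite -nE iterD; apply: chain_orbit; exact: ltW.
move=> i ik; have [+ _] := Hw1 i; have [iP|] := ltnP i P.
  by rewrite modn_small // Wk.
by rewrite /P => Pi; exfalso; lia.
Qed.

(** Shadow longer and longer finite windows that have their ends in the class,
    and take a limit of the shadowing points. *)
Lemma class_shadowing_two_sided f C : cw_hyperbolic f -> chain_recurrent_class f C ->
  forall e, 0 < e -> exists2 r, 0 < r & forall p : int -> X,
  (forall i, d (f (p i)) (p (i + 1)) <= r) ->
  (forall n : nat, exists a b : nat,
     [/\ (n <= a)%N, (n <= b)%N, C (p (- a%:Z)) & C (p b%:Z)]) ->
  exists2 z, C z & forall i, d (hiterz f i z) (p i) <= e.
Proof.
move=> fcw fC e e0; have [r r0 Hr] := class_shadowing fcw fC e0.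
exists r => // p pP pC.
have /choice [q Hq] (n : nat) : exists q, C q /\
    forall i : int, (`|i| <= n)%N -> d (hiterz f i q) (p i) <= e.
  have [a [b [na nb Ca Cb]]] := pC n.
  have [||i ik|w Cw Hw] := Hr (fun i => p (i%:Z - a%:Z)) (a + b)%N.
  - by rewrite sub0r.
  - by rewrite PoszD addrAC subrr add0r.
  - have -> : i.+1%:Z - a%:Z = i%:Z - a%:Z + 1 by lia.
    exact: pP.
  exists (iter a f w); split; first exact: class_iter fC _ _ Cw.
  move=> i ni; have [m mE] : exists m : nat, m%:Z = i + a%:Z by exists (absz (i + a%:Z)); lia.
  rewrite -[iter a f w]/(hiterz f a%:Z w) -hiterzD -mE.
  have -> : i = m%:Z - a%:Z by lia.
  apply: Hw; lia.
have [z Hz] := cluster_point Xc q; exists z.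
  by apply: (class_closed Xc fC) => g g0; have [n _ zn] := Hz g 0%N g0; exists (q n) => //;
    have [] := Hq n.
move=> i; apply: mdist_limit_le_cst; first exact: hiterz_continuous.
move=> g g0; have [n ni zn] := Hz g `|i|%N g0; exists (q n) => //.
by have [_] := Hq n; apply.
Qed.

Lemma class_transitive f C : cw_hyperbolic f -> chain_recurrent_class f C -> transitive_on f C.
Proof.
move=> fcw fC U V /open_mdistP oU /open_mdistP oV [x [Cx /oU [a a0 Ua]]] [y [Cy /oV [b b0 Vb]]].
have e0 : 0 < Num.min (a / 2) (b / 2) by rewrite lt_min !divr_gt0.
have [r r0 Hr] := class_shadowing fcw fC e0.
have [k [u [k0 ux uy uP]]] := class_reach fC Cx Cy r0.
have [||//|w Cw Hw] := Hr u k; rewrite ?ux ?uy //.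
have := Hw 0%N (leq0n _); have := Hw k (leqnn _); rewrite ux uy !le_min => /andP[_ wy] /andP[wx _].
exists k, (iter k f w); split; last first.
  by split; [exact: class_iter fC _ _ Cw|apply: Vb; rewrite metric_sym; lra].
by exists w => //; split=> //; apply: Ua; rewrite metric_sym; move: wx => /=; lra.
Qed.

End ClassShadowing.

(** * Periodic decomposition *)

(** The period is the least positive difference [n] of two elements.  If [a] and
    [a + n] are in [S] and [a = q * n], then every [m * n] with [m >= q * q] is
    a combination of [a] and [a + n]. *)
Lemma semigroup_period (S : nat -> Prop) : S 0%N ->
  (forall a b, S a -> S b -> S (a + b)%N) -> (exists2 k, (0 < k)%N & S k) ->
  exists n, [/\ (0 < n)%N, (forall k, S k -> (n %| k)%N) &
    exists B, forall m, (B <= m)%N -> S (m * n)%N].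
Proof.
move=> S0 SD [k0 k00 Sk0].
have SM j a : S a -> S (j * a)%N.
  by move=> Sa; elim: j => [|j IHj] //; rewrite mulSn; exact: SD.
pose D n := (0 < n)%N /\ exists a, [/\ (0 < a)%N, S a & S (a + n)%N].
have exD : exists n, `[< D n >].
  by exists k0; apply/asboolP; split=> //; exists k0; split=> //; exact: SD.
case: (ex_minnP exD) => n /asboolP [n0 [a [a0 Sa San]]] nmin.
have nS s : S s -> (n %| s)%N.
  move=> Ss; rewrite /dvdn -leqn0 leqNgt; apply/negP => t0.
  have : (n <= s %% n)%N.
    apply/nmin/asboolP; split=> //; exists ((s %/ n) * (a + n) + a)%N.
    split; [by rewrite addn_gt0 a0 orbT|by apply: SD => //; exact: SM|].
    have -> : ((s %/ n) * (a + n) + a + s %% n = (s %/ n) * a + s + a)%N.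
      have := divn_eq s n; move: (s %/ n)%N (s %% n)%N => u v ->; rewrite mulnDr; lia.
    by apply: (SD) => //; apply: SD => //; exact: SM.
  by rewrite leqNgt ltn_mod n0.
exists n; split=> //; have /dvdnP [q aE] := nS a Sa.
have q0 : (0 < q)%N by move: a0; rewrite aE muln_gt0 => /andP[].
exists (q * q)%N => m qm.
have uq : (q <= m %/ q)%N by rewrite leq_divRL.
have rq : (m %% q < q)%N by rewrite ltn_mod.
have -> : (m * n = (m %/ q - m %% q) * a + (m %% q) * (a + n))%N.
  rewrite {1}(divn_eq m q) aE mulnBl mulnDr addnA subnK ?mulnDl ?mulnA //.
  by rewrite -!mulnA leq_mul2r (leq_trans (ltnW rq) uq) orbT.
by apply: SD; exact: SM.
Qed.

Section Decomposition.
Variables (R : realType) (X : metricType R).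
Implicit Types (f : homeo X) (x y z : X) (A C : set X) (e r : R) (k l : nat).
Local Notation d := (@mdist R X).
Hypothesis Xc : compact [set: X].

Lemma iter_hiter f n m x : iter m (hiter f n) x = iter (m * n) f x.
Proof. by elim: m => [|m IHm] //=; rewrite mulSn iterD -IHm. Qed.

Section Phase.
Variables (f : homeo X) (C : set X) (x0 : X).
Hypotheses (fcw : cw_hyperbolic f) (fC : chain_recurrent_class f C) (Cx0 : C x0).

Lemma class_chain e x y : 0 < e -> C x -> C y -> exists k, chain f e k x y.
Proof.
by move=> e0 Cx Cy; have /eps_chainP [k _] := class_reach fC Cx Cy e0; exists k.
Qed.

Definition loop_divisor e n := forall k, chain f e k x0 x0 -> (n %| k)%N.

Lemma chain_phase e n x y k l : 0 < e -> loop_divisor e n -> C x -> C y ->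
  chain f e k x y -> chain f e l x y -> k = l %[mod n].
Proof.
move=> e0 en Cx Cy xyk xyl.
have [p x0x] := class_chain e0 Cx0 Cx; have [q yx0] := class_chain e0 Cy Cx0.
have /eqP kn := en _ (chain_cat (chain_cat x0x xyk) yx0).
have /eqP ln := en _ (chain_cat (chain_cat x0x xyl) yx0).
by apply/eqP; rewrite -(eqn_modDl p) -(eqn_modDr q) kn ln.
Qed.

(** At every scale [e], a chain of the length of an orbit joins the past of [y]
    to the future of [x]; this is why [r] can be chosen before [e]. *)
Lemma phase_locally_constant : exists2 r, 0 < r &
  forall e n x y k l, 0 < e -> loop_divisor e n -> C x -> C y -> d x y < r ->
  chain f e k x0 x -> chain f e l x0 y -> k = l %[mod n].
Proof.
have [r r0 Hr] := local_product_chain Xc fcw; exists r => // e n x y k l e0 en Cx Cy xy ck cl.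
have [K _ [L cKL]] := Hr x y xy e e0.
have Ct : C (iter K (hinv f) y) by rewrite -hiterzN; exact: (class_hiterz Xc fC).
have [p cp] := class_chain e0 Cx0 Ct.
have e0' := ltW e0.
have c1 : chain f e (p + K) x0 y.
  by apply: chain_cat cp _; rewrite -{2}(iter_hinvK f K y); exact: chain_orbit.
have c2 : chain f e (k + L) x0 (iter L f x) by apply: chain_cat ck _; exact: chain_orbit.
have h1 := chain_phase e0 en Cx0 Cy c1 cl.
have h2 := chain_phase e0 en Cx0 (class_iter Xc fC L Cx) c2 (chain_cat cp cKL).
by rewrite -h1; apply/eqP; rewrite -(eqn_modDr L) h2 addnA.
Qed.

(** The period of the loops at scale [e] increases when [e] decreases, but the
    orbit of [x0] returns close to itself, and the corresponding difference of
    times is a multiple of all the periods. *)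
Lemma class_period : exists n e0, [/\ (0 < n)%N, 0 < e0 &
  forall e, 0 < e -> e <= e0 -> loop_divisor e n /\
    exists B, forall m, (B <= m)%N -> chain f e (m * n) x0 x0].
Proof.
have per e : 0 < e -> exists n, [/\ (0 < n)%N, loop_divisor e n &
    exists B, forall m, (B <= m)%N -> chain f e (m * n) x0 x0].
  move=> e0; apply: semigroup_period.
  - by exists (fun _ => x0).
  - by move=> a b ca cb; exact: chain_cat ca cb.
  - by have /eps_chainP := class_reach fC Cx0 Cx0 e0.
have [r r0 Hr] := phase_locally_constant.
have [t Ht] := cluster_point Xc (fun i => iter i f x0); have r2 : 0 < r / 2 by rewrite divr_gt0.
have [i _ ti] := Ht (r / 2) 0%N r2; have [j ij tj] := Ht (r / 2) i.+1 r2.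
have Jn e n : 0 < e -> loop_divisor e n -> (n <= j - i)%N.
  move=> e0 en; apply: dvdn_leq; first by rewrite subn_gt0.
  rewrite -eqn_mod_dvd ?(ltnW ij) //; apply/eqP.
  apply: (Hr e n (iter j f x0) (iter i f x0)) => //; try exact: (class_iter Xc fC).
  - have := metric_triangle (iter j f x0) t (iter i f x0).
    have := metric_sym (iter j f x0) t; lra.
  - by apply: chain_orbit; exact: ltW.
  - by apply: chain_orbit; exact: ltW.
pose P n := exists e, [/\ (0 < n)%N, 0 < e & loop_divisor e n /\
  exists B, forall m, (B <= m)%N -> chain f e (m * n) x0 x0].
have exP : exists n, `[< P n >].
  by have [n [n0 en eB]] := per 1 ltr01; exists n; apply/asboolP; exists 1.
have Pmax n : `[< P n >] -> (n <= j - i)%N.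
  by move=> /asboolP [e [_ e0 [en _]]]; exact: Jn en.
case: (ex_maxnP exP Pmax) => n /asboolP [e0 [n0 e00 [en _]]] nmax.
exists n, e0; split=> // e e_gt0 ee0.
have [n' [n'0 en' [B HB]]] := per e e_gt0.
suff -> : n = n' by split=> //; exists B.
apply/eqP; rewrite eqn_leq; apply/andP; split; last first.
  by apply/nmax/asboolP; exists e; split=> //; split=> //; exists B.
apply: dvdn_leq => //.
have nB m : (B <= m)%N -> (n %| m * n')%N by move=> /HB /(chainW ee0); exact: en.
by have := nB B.+1 (leqnSn B); rewrite mulSn dvdn_addl // nB.
Qed.

(** The pieces are the sets of points of a given phase modulo the stable period
    [n].  They are relatively open because the phase is locally constant, and
    [iter n f] is mixing on each of them because any two of their points are
    joined, at every scale, by chains of all large lengths divisible by [n]. *)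
Lemma class_decomposition : exists n (D : 'I_n -> set X), elementary_decomposition f C D.
Proof.
have [n [e0 [n0 e00 Hn]]] := class_period; have [en _] := Hn e0 e00 (lexx _).
have [r r0 Hr] := phase_locally_constant.
pose D (i : 'I_n) := [set y | C y /\ exists2 k, (k %% n)%N = i & chain f e0 k x0 y].
have phase y (Cy : C y) : exists i : 'I_n, D i y.
  have [k ck] := class_chain e00 Cx0 Cy.
  by exists (Ordinal (ltn_pmod k n0)); split=> //; exists k.
have Dinj i j y : D i y -> D j y -> i = j.
  move=> [Cy [k ki ck]] [_ [l lj cl]]; apply: val_inj.
  by rewrite /= -ki -lj; exact: (chain_phase e00 en Cx0 Cy ck cl).
have Dnear i x y : C x -> D i y -> d x y < r -> D i x.
  move=> Cx [Cy [k ki ck]] xy; split=> //; have [l cl] := class_chain e00 Cx0 Cx.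
  by exists l => //; rewrite -ki; exact: (Hr e0 n x y).
have Dimg i y : D i y -> D (ordS i) (f y).
  move=> [Cy [k ki ck]]; split; first exact: (class_image Xc fC).
  exists (k + 1)%N; first by rewrite -modnDml ki /= addn1.
  by apply: chain_cat ck _; apply: chain1; rewrite mdistxx ltW.
exists n, D; split=> //.
- split.
  + apply/seteqP; split=> [y [i _ [Cy _]] //|y Cy].
    by have [i Di] := phase y Cy; exists i.
  + by move=> i j _ _ [y [Di Dj]]; exact: Dinj Di Dj.
  + move=> i _; exists (iter i f x0); split; first exact: (class_iter Xc fC).
    by exists i; [rewrite modn_small|apply: chain_orbit; exact: ltW].
- move=> i; apply: (subclosed_compact _ (class_compact Xc fC)); last by move=> y [].
  move=> x /closure_mdistP Dx.
  have Cx : C x.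
    by apply: (class_closed Xc fC) => s s0; have [y [Cy _] xy] := Dx s s0; exists y.
  by have [y Dy xy] := Dx r r0; exact: (Dnear i x y).
- move=> i; apply/seteqP; split=> [_ [y Dy <-]|y Dy]; first exact: Dimg.
  have [j Dj] : exists j, D j (hinv f y) by apply: phase; apply: (class_hinv Xc fC); case: Dy.
  exists (hinv f y); last exact: hinvK.
  have := Dimg j _ Dj; rewrite hinvK => Dj'.
  by have /ordS_inj <- := Dinj _ _ _ Dj' Dy.
- move=> i U V /open_mdistP oU /open_mdistP oV [x [Dx /oU [a a0 Ua]]] [y [Dy /oV [b b0 Vb]]].
  pose e := Num.min (r / 2) (Num.min (a / 2) (b / 2)).
  have e_gt0 : 0 < e by rewrite !lt_min !divr_gt0.
  have [er ea eb] : [/\ e < r, e < a & e < b].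
    have : e <= e by []; rewrite {2}/e !le_min => /and3P[? ? ?]; split; lra.
  have [s s0 Hs] := class_shadowing Xc fcw fC e_gt0.
  pose t := Num.min s e0; have t0 : 0 < t by rewrite lt_min s0.
  have [ts te] : t <= s /\ t <= e0 by rewrite !ge_min !lexx orbT.
  have [_ [B HB]] := Hn t t0 te.
  have [[Cx [k ki ck]] [Cy [l li cl]]] := (Dx, Dy).
  have [p cp] := class_chain t0 Cx Cx0; have [q cq] := class_chain t0 Cx0 Cy.
  have npq : (n %| p + q)%N.
    have ql := chain_phase e00 en Cx0 Cy (chainW te cq) cl.
    have /eqP kp := en _ (chain_cat ck (chainW te cp)).
    by rewrite /dvdn (addnC p) -modnDml ql li -ki modnDml kp.
  exists (p + q + B)%N => m mN.
  have [v vE] : exists v, (m * n = p + v * n + q)%N /\ (B <= v)%N.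
    have [w wE] := dvdnP npq; exists (m - w)%N.
    have wpq : (w <= p + q)%N by rewrite wE leq_pmulr.
    have wm : (w + B <= m)%N by apply: leq_trans mN; rewrite leq_add2r.
    have {}wm : (w <= m)%N /\ (B <= m - w)%N.
      split; first exact: leq_trans (leq_addr B w) wm.
      by rewrite leq_subRL // (leq_trans (leq_addr B w) wm).
    by split; [rewrite addnAC wE -mulnDl subnKC //; case: wm|case: wm].
  have [u [ux uy uP]] := chain_cat (chain_cat cp (HB v vE.2)) cq.
  rewrite -vE.1 in uy uP.
  have [||j jm|w Cw Hw] := Hs u (m * n)%N; rewrite ?ux ?uy //.
    by apply: le_trans (uP j jm) ts.
  have := Hw 0%N (leq0n _); have := Hw _ (leqnn _); rewrite ux uy => wy wx.
  have Dw : D i w by apply: (Dnear i w x) => //; exact: le_lt_trans wx er.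
  exists (iter (m * n) f w); split.
    exists w; last exact: iter_hiter.
    by split=> //; apply: Ua; rewrite metric_sym; exact: le_lt_trans wx ea.
  split; last by apply: Vb; rewrite metric_sym; exact: le_lt_trans wy eb.
  apply: (Dnear i _ y) => //; last exact: le_lt_trans wy er.
  exact: (class_iter Xc fC).
Qed.

End Phase.
End Decomposition.

(** * Semihorseshoes *)

Lemma shift_space_cvg (F : set_system shift_space) (s : shift_space) : Filter F ->
  (forall i, F [set t | t i = s i]) -> F --> s.
Proof.
move=> FF Fs; apply/cvg_sup => i A; rewrite nbhsE => -[B [[V oV BV] Bs] BA].
apply: filterS (Fs i) => t ts; apply: BA; move: Bs; rewrite -BV /=.
by rewrite /proj ts.
Qed.

Lemma int_block (i : int) (k : nat) : (0 < k)%N ->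
  exists (q : int) (j : nat), (j < k)%N /\ i = q * k%:Z + j%:Z.
Proof.
move=> k0; have k0' : k%:Z != 0 by case: k k0.
exists (i %/ k)%Z, (absz (i %% k)%Z).
have := modz_ge0 i k0'; have := ltz_mod i k0'; have := divz_eq i k.
move: (i %/ k)%Z (i %% k)%Z => q r ->; lia.
Qed.

Section Horseshoe.
Variables (R : realType) (X : metricType R).
Implicit Types (f : homeo X) (x y z : X) (A C : set X) (e r g : R) (k l : nat).
Local Notation d := (@mdist R X).

Lemma closed_mdist_le (h : X -> X) y c : continuous h -> closed [set x | d (h x) y <= c].
Proof.
move=> hc x /closure_mdistP clx; apply: mdist_limit_le_cst => // e e0.
by have [x' xc xx] := clx e e0; exists x'.
Qed.

Hypothesis Xc : compact [set: X].

(** Local products transported to an arbitrary integer time, so that several of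
    them can be taken along the same orbit. *)
Lemma local_product_at f : cw_hyperbolic f -> forall e, 0 < e ->
  exists r (rate : R -> nat), 0 < r /\
  forall (t : int) x y, d (hiterz f t x) (hiterz f t y) < r -> exists z,
    [/\ forall i, t <= i -> d (hiterz f i x) (hiterz f i z) <= e,
        forall i, i <= t -> d (hiterz f i y) (hiterz f i z) <= e,
        forall g i, 0 < g -> t + (rate g)%:Z <= i -> d (hiterz f i x) (hiterz f i z) < g &
        forall g i, 0 < g -> i <= t - (rate g)%:Z -> d (hiterz f i y) (hiterz f i z) < g].
Proof.
move=> fcw e e0; have [r [N [r0 H]]] := cw_local_product Xc fcw e0.
exists r, N; split=> // t x y /H [z [xz yz Nxz Nyz]]; exists (hiterz f (- t) z).
have fut i : t <= i -> exists n : nat, i = n%:Z + t.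
  by move=> ti; exists (absz (i - t)); lia.
have past i : i <= t -> exists n : nat, i = - n%:Z + t.
  by move=> ti; exists (absz (t - i)); lia.
have tz : hiterz f t (hiterz f (- t) z) = z by rewrite -hiterzD subrr.
split=> [i /fut [n ->]|i /past [n ->]|g i g0 ti|g i g0 ti].
- by rewrite !hiterzD tz; exact: xz.
- by rewrite !hiterzD tz !hiterzN; exact: yz.
- have [|n iE] := fut i; first lia.
  rewrite iE !hiterzD tz; apply: Nxz => //; lia.
- have [|n iE] := past i; first lia.
  rewrite iE !hiterzD tz !hiterzN; apply: Nyz => //; lia.
Qed.

(** Start from distinct points [x] and [y] with close orbits.  A first local
    product, long before time 0, follows [x] in the past and [y] afterwards; a
    second one, long after time 0, returns to [x].  Uniform contraction makes
    the result close to [y] at time 0, hence distinct from [x]. *)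
Lemma doubly_asymptotic_pair f C : cw_hyperbolic f -> ~ expansive_on f C ->
  forall e, 0 < e -> exists x w, [/\ C x, x <> w,
    forall i, d (hiterz f i x) (hiterz f i w) <= e &
    forall g, 0 < g -> exists N : nat, forall i : int, (N <= `|i|)%N ->
      d (hiterz f i x) (hiterz f i w) < g].
Proof.
move=> fcw nexp e e0; have e4 : 0 < e / 4 by rewrite divr_gt0.
have [r1 [N1 [r10 H1]]] := local_product_at fcw e4.
have [e2 [e20 e2e e2r]] : exists e2, [/\ 0 < e2, e2 <= e / 4 & e2 <= r1 / 4].
  by exists (Num.min (e / 4) (r1 / 4)); rewrite lt_min e4 divr_gt0 // !ge_min !lexx orbT.
have [r2 [N2 [r20 H2]]] := local_product_at fcw e20.
have [c [c0 ce cr1 cr2]] : exists c, [/\ 0 < c, c <= e / 4, c <= r1 / 2 & c <= r2 / 2].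
  exists (Num.min (e / 4) (Num.min (r1 / 2) (r2 / 2))).
  by rewrite !lt_min e4 !divr_gt0 // !ge_min !lexx !orbT.
have [x [y [Cx xy yW]]] : exists x y, [/\ C x, x <> y & (Ws f c x `&` Wu f c x) y].
  apply: contrapT => H; apply: nexp; exists c => // x Cx; apply/seteqP; split.
    move=> y [Wy Cy]; apply: contrapT => nyx; apply: H.
    by exists x, y; split=> // xy; apply: nyx; rewrite xy.
  move=> _ ->; split=> //; split; first exact: Ws_refl.
  exact: (@Ws_refl _ _ (homeo_inv f)).
have {yW} xyc i : d (hiterz f i x) (hiterz f i y) <= c.
  by case: yW => [sy uy]; case: i => n; [exact: sy|exact: (uy n.+1)].
have [g gE] : exists g, g = d x y / 2 by exists (d x y / 2).
have g0 : 0 < g by rewrite gE divr_gt0 // mdist_gt0; apply/eqP.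
(* after [K] steps both contractions are below half the distance of [x], [y] *)
have [K [K1 K2]] : exists K, (N1 g <= K)%N /\ (N2 g <= K)%N.
  by exists (maxn (N1 g) (N2 g)); rewrite leq_maxl leq_maxr.
have [|z [z1 z2 z3 z4]] := H2 (- K%:Z) y x.
  by rewrite metric_sym; apply: le_lt_trans (xyc _) _; lra.
have [|w [w1 w2 w3 w4]] := H1 K%:Z x z.
  have := xyc K; have [] : d (hiterz f K y) (hiterz f K z) <= e2 by apply: z1; clear; lia.
  have := metric_triangle (hiterz f K x) (hiterz f K y) (hiterz f K z); lra.
exists x, w; split=> //.
- move=> xw; have : d y z < g by apply: (z3 g 0) => //; clear -K2; lia.
  have : d z w < g by apply: (w4 g 0) => //; clear -K1; lia.
  have := metric_triangle y z w; have := metric_sym x y; rewrite -xw; lra.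
- move=> i; have [Ki|iK] := leP (K : int) i; first by have := w1 i Ki; lra.
  have := w2 i (ltW iK); have := metric_triangle (hiterz f i x) (hiterz f i z) (hiterz f i w).
  have : d (hiterz f i x) (hiterz f i z) <= e2 + c.
    have [Ki|/ltW Ki] := leP (- (K : int)) i.
      have := z1 i Ki; have := xyc i.
      have := metric_triangle (hiterz f i x) (hiterz f i y) (hiterz f i z); lra.
    by have := z2 i Ki; lra.
  lra.
- move=> h h0; have h2 : 0 < h / 2 by rewrite divr_gt0.
  exists (K + N1 (h / 2)%R + N2 (h / 2)%R + N1 h)%N => i Ni.
  have [i0|i0] := leP 0 i; first by apply: w3 => //; clear -Ni i0; lia.
  have : d (hiterz f i z) (hiterz f i w) < h / 2 by apply: w4 => //; clear -Ni i0; lia.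
  have : d (hiterz f i x) (hiterz f i z) < h / 2 by apply: z4 => //; clear -Ni i0; lia.
  have := metric_triangle (hiterz f i x) (hiterz f i z) (hiterz f i w); lra.
Qed.

Lemma totally_disconnectedS A B : A `<=` B -> totally_disconnected B -> totally_disconnected A.
Proof.
move=> AB tB x Ax; apply/seteqP; split=> [y Ay|_ ->]; last exact: connected_component_refl.
rewrite -(tB x (AB _ Ax)).
apply: (@connected_component_max _ _ (connected_component A x)) Ay => //.
- exact: connected_component_refl.
- by apply: subset_trans AB; exact: connected_component_sub.
- exact: component_connected.
Qed.

(** Two loops of the same length through a common point that are close to each
    other but apart at some time: concatenating them along a sequence of symbols
    gives pseudo-orbits, and the points that shadow them form a set on which the
    sequence of symbols can be read. *)
Lemma horseshoe_of_loops f C e g : cw_hyperbolic f -> chain_recurrent_class f C ->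
  0 < e -> 0 < g ->
  (forall r, 0 < r -> exists k j0 (loop : bool -> nat -> X),
    [/\ (j0 < k)%N, g <= d (loop true j0) (loop false j0),
        C (loop true 0%N) /\ (forall b, loop b 0%N = loop true 0%N /\ loop b k = loop true 0%N),
        forall b b' j, (j < k)%N -> d (loop b j) (loop b' j) <= e &
        forall b j, (j < k)%N -> d (f (loop b j)) (loop b j.+1) <= r]) ->
  exists (K : set X) (k : nat),
    [/\ [/\ compact K, K `<=` C & (0 < k)%N], iter k f @` K = K,
        forall i z z', K z -> K z' -> d (hiterz f i z) (hiterz f i z') <= 2 * e &
        exists h : X -> shift_space,
          [/\ {within K, continuous h}, h @` K = [set: shift_space] &
              forall x, K x -> h (iter k f x) = shift_map (h x)]].
Proof.
move=> fcw fC e0 g0 H.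
pose p := Num.min (e / 2) (g / 3); have p0 : 0 < p by rewrite lt_min !divr_gt0.
have [pe pg] : p <= e / 2 /\ p <= g / 3 by apply/andP; rewrite -le_min.
have [r r0 Hr] := class_shadowing_two_sided Xc fcw fC p0.
have [k [j0 [loop [j0k gj0 [CL L0] Le Lr]]]] := H r r0.
have k0 : (0 < k)%N by apply: leq_ltn_trans j0k.
have kz : k%:Z != 0 by case: (k) k0.
pose E b := [set z | forall j, (j < k)%N -> d (iter j f z) (loop b j) <= p].
have Edis z : E true z -> E false z -> False.
  move=> /(_ _ j0k) Et /(_ _ j0k) Ef.
  have := metric_triangle (loop true j0) (iter j0 f z) (loop false j0).
  have := metric_sym (loop true j0) (iter j0 f z); lra.
have Ecl b : closed (E b).
  have -> : E b = \bigcap_(j in [set j | (j < k)%N]) [set z | d (iter j f z) (loop b j) <= p].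
    by apply/seteqP; split.
  apply: closed_bigI => j _; apply: closed_mdist_le.
  by apply: iter_continuous; exact: hfun_continuous.
pose F q := hiterz f (q * k%:Z) @^-1` (E true `|` E false).
have Fcl q : closed (F q).
  apply: preimage_closed; last by apply: closedU; exact: Ecl.
  by move=> x _; exact: hiterz_continuous.
pose K := C `&` \bigcap_(q in [set: int]) F q.
have Kcl : closed K.
  apply: closedI; last by apply: closed_bigI => q _.
  by apply: compact_closed; [exact: metric_hausdorff|exact: (class_compact Xc fC)].
have KC : K `<=` C by move=> z [].
have KE z q : K z -> exists b, E b (hiterz f (q * k%:Z) z).
  by move=> [_ /(_ q I)] [|]; [exists true|exists false].
have EK z : C z -> (forall q, exists b, E b (hiterz f (q * k%:Z) z)) -> K z.
  by move=> Cz Ez; split=> // q _; have [[|] ?] := Ez q; [left|right].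
have Kpt (s : int -> bool) : exists2 z, K z & forall q, E (s q) (hiterz f (q * k%:Z) z).
  (* the pseudo-orbit that runs through the loop [s q] during the block [q] *)
  pose P (i : int) := loop (s (i %/ k)%Z) (absz (i %% k)%Z).
  have PE q j : (j < k)%N -> P (q * k%:Z + j%:Z) = loop (s q) j.
    move=> jk; have jk' : (j%:Z < k%:Z) by [].
    rewrite /P divzMDl // modzMDl divz_small ?modz_small ?addr0 //; exact/andP.
  have [i||z Cz Hz] := Hr P.
  - have [q [j [jk ->]]] := int_block i k0; rewrite PE //.
    have := Lr (s q) j jk; rewrite -addrA -PoszD addn1; have [jk1|] := ltnP j.+1 k.
      by rewrite PE.
    move=> kj; have jE : j.+1 = k by apply/eqP; rewrite eqn_leq jk.
    rewrite jE; have -> : q * k%:Z + k%:Z = (q + 1) * k%:Z + 0%N%:Z.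
      by rewrite mulrDl mul1r addr0.
    by rewrite PE // (L0 (s q)).2 (L0 (s _)).1.
  - move=> n; have nk : (n <= n * k)%N by rewrite leq_pmulr.
    exists (n * k)%N, (n * k)%N; split=> //.
      by have := PE (- n%:Z) 0%N k0; rewrite addr0 mulNr -PoszM => ->; rewrite (L0 _).1.
    by have := PE n%:Z 0%N k0; rewrite addr0 -PoszM => ->; rewrite (L0 _).1.
  have Ez q : E (s q) (hiterz f (q * k%:Z) z).
    move=> j jk; rewrite -(PE q j jk) addrC -[iter j f _]/(hiterz f j%:Z _) -hiterzD.
    exact: Hz.
  by exists z => //; apply: EK => // q; exists (s q).
pose h (z : X) : shift_space := fun q => `[< E true (hiterz f (q * k%:Z) z) >].
have shiftE q z : hiterz f (q * k%:Z) (iter k f z) = hiterz f ((q + 1) * k%:Z) z.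
  by rewrite -[iter k f z]/(hiterz f k%:Z z) -hiterzD mulrDl mul1r.
have shiftE' q z : hiterz f (q * k%:Z) (iter k (hinv f) z) = hiterz f ((q - 1) * k%:Z) z.
  by rewrite -hiterzN -hiterzD mulrBl mul1r.
exists K, k; split.
- by split=> //; apply: (subclosed_compact Kcl (class_compact Xc fC)).
- apply/seteqP; split=> [_ [z Kz <-]|z Kz].
    apply: EK; first by apply: (class_iter Xc fC); exact: KC.
    by move=> q; rewrite shiftE; exact: KE.
  exists (iter k (hinv f) z); last exact: iter_hinvK.
  apply: EK; first by rewrite -hiterzN; apply: (class_hiterz Xc fC); exact: KC.
  by move=> q; rewrite shiftE'; exact: KE.
- move=> i z z' Kz Kz'; have [q [j [jk ->]]] := int_block i k0.
  have [b /(_ j jk)] := KE z q Kz; have [b' /(_ j jk)] := KE z' q Kz'.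
  rewrite ![q * _ + _]addrC !hiterzD /=; set u := hiterz f _ z; set u' := hiterz f _ z'.
  have := Le b b' j jk; have := metric_triangle (iter j f u) (loop b j) (iter j f u').
  have := metric_triangle (loop b j) (loop b' j) (iter j f u').
  have := metric_sym (loop b' j) (iter j f u'); lra.
- exists h; split.
  + apply/subspace_continuousP => x Kx; apply: shift_space_cvg => q.
    have [b Eb] := KE x q Kx.
    have Enot : ~ E (~~ b) (hiterz f (q * k%:Z) x).
      by case: b Eb => Et Ef; [exact: (Edis _ Et Ef)|exact: (Edis _ Ef Et)].
    have nb : nbhs x (hiterz f (q * k%:Z) @^-1` (~` E (~~ b))).
      apply: open_nbhs_nbhs; split=> //; apply: open_comp; last by apply: closed_openC; exact: Ecl.
      by move=> y _; exact: hiterz_continuous.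
    rewrite /nbhs /= /within /=; apply: filterS (nb) => y /= nEy Ky; rewrite /h.
    have [b' Eb'] := KE y q Ky.
    have bb' : b' = b by case: b b' {nb} Enot nEy Eb' Eb => [] [].
    rewrite bb' in Eb'; case: b Eb Eb' {Enot nb nEy bb'} => Ex Ey.
      by apply/asboolP/asboolP.
    by apply: asbool_equiv_eq; split=> Et; [case: (Edis _ Et Ey)|case: (Edis _ Et Ex)].
  + apply/seteqP; split=> // s _; have [z Kz Ez] := Kpt s; exists z => //.
    apply/funext => q; rewrite /h; have := Ez q; case: (s q) => Es.
      exact/asboolP.
    by apply/asboolPn => Et; exact: (Edis _ Et Es).
  + by move=> x Kx; apply/funext => q; rewrite /h /shift_map shiftE.
Qed.

(** One loop follows the orbit of [x], the other one the orbit of a point that is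
    asymptotic to it in both time directions; the same chain closes both of them.
    The resulting set has small diameter at all times, hence lies in intersections
    of local stable and unstable sets, which are totally disconnected. *)
Lemma class_semihorseshoes f C : cw_hyperbolic f -> chain_recurrent_class f C ->
  ~ expansive_on f C -> small_td_semihorseshoes f C.
Proof.
move=> fcw fC nexp e e0; have [[c c0 fc] _] := fcw.
pose a := Num.min e c / 2; have a0 : 0 < a by rewrite divr_gt0 // lt_min e0.
have [ae ac] : 2 * a <= e /\ 2 * a <= c.
  by apply/andP; rewrite -le_min /a mulrCA mulfV ?mulr1 // pnatr_eq0.
have [x [w [Cx xw xwa asy]]] := doubly_asymptotic_pair fcw nexp a0.
have g0 : 0 < d x w by rewrite mdist_gt0; apply/eqP.
have [|K [k [[Kc KC k0] fK Kd Kh]]] := @horseshoe_of_loops f C a (d x w) fcw fC a0 g0; last first.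
  exists K, k; split=> //.
    split=> // x0 Kx0; apply: (totally_disconnectedS _ (fc x0)) => // y Ky.
    split=> n; apply: le_trans ac; last exact: (Kd n%:Z).
    by rewrite -!hiterzN; exact: Kd.
  move=> i; apply: ge_ereal_sup => _ [[_ _] [[y Ky <-] [z Kz <-]] <-] /=.
  by rewrite lee_fin; apply: le_trans ae; exact: Kd.
move=> r r0; have [N HN] := asy r r0.
pose m := N.+1; pose X0 := hiterz f (- m%:Z) x; pose X1 := hiterz f m%:Z x.
have CX0 : C X0 by exact: (class_hiterz Xc fC).
have CX1 : C X1 by exact: (class_hiterz Xc fC).
have [l [v [l0 v0 vl vP]]] := class_reach fC CX1 CX0 r0.
pose loop (b : bool) j := if (j < m + m)%N then
  hiterz f (j%:Z - m%:Z) (if b && (0 < j)%N then w else x) else v (j - (m + m))%N.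
have r0' := ltW r0.
exists (m + m + l)%N, m, loop; split.
- by rewrite /m; lia.
- have m0 : (0 < m)%N by [].
  have mm : (m < m + m)%N by rewrite -{1}[m]addn0 ltn_add2l.
  by rewrite /loop mm m0 /= subrr metric_sym.
- have L0 b : loop b 0%N = X0 by rewrite /loop andbF sub0r.
  rewrite !L0; split=> // b; rewrite L0; split=> //.
  by rewrite /loop ltnNge leq_addr /= addKn.
- move=> b b' j _; rewrite /loop; case: ifP => _; last by rewrite mdistxx ltW.
  case: ifP => _; case: ifP => _; rewrite ?mdistxx ?(ltW a0) //.
  by rewrite metric_sym.
- move=> b j jl; rewrite /loop; have [jm|jm] := ltnP j (m + m)%N; last first.
    rewrite ltnNge (leq_trans jm (leqnSn _)) /= subSn //; apply: vP; lia.
  have jS : j.+1%:Z - m%:Z = j%:Z - m%:Z + 1 by lia.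
  rewrite andbT; have [jm1|jm1] := ltnP j.+1 (m + m)%N.
    rewrite jS -hiterzS; case: j jS jm jm1 {jl} => [|j] jS jm jm1; last by rewrite andbT mdistxx.
    rewrite andbF; case: b; last by rewrite mdistxx.
    apply/ltW/HN; rewrite /m; lia.
  have jE : j.+1 = (m + m)%N by lia.
  have j0 : (0 < j)%N by move: jE; rewrite /m; lia.
  rewrite jE subnn v0 -hiterzS -jS jE j0 andbT.
  have -> : (m + m)%N%:Z - m%:Z = m%:Z by lia.
  rewrite /X1; case: b; last by rewrite mdistxx.
  by rewrite metric_sym; apply/ltW/HN; rewrite /m; lia.
Qed.

End Horseshoe.

(** * Iterates, elementary sets and specification *)

Section Powers.
Variables (R : realType) (X : metricType R).
Implicit Types (f : homeo X) (x y z : X) (A C : set X) (e r g c : R) (k l n m : nat).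
Local Notation d := (@mdist R X).
Hypothesis Xc : compact [set: X].

Lemma connected_componentS A B x :
  A `<=` B -> connected_component A x `<=` connected_component B x.
Proof. by move=> AB y [E [Ex EA cE] Ey]; exists E => //; split=> //; exact: subset_trans AB. Qed.

Lemma Ws_hiter f n c : (0 < n)%N -> 0 < c ->
  exists2 c', 0 < c' & forall x, Ws (hiter f n) c' x `<=` Ws f c x.
Proof.
move=> n0 c0; have [r r0 Hr] := uniform_continuity_iter Xc n (@hfun_continuous _ f) c0.
exists (r / 2); first by rewrite divr_gt0.
move=> x y xy m; rewrite (divn_eq m n) addnC !iterD -!iter_hiter.
by apply/ltW/Hr; [have := xy (m %/ n)%N; lra|rewrite ltnW // ltn_mod].
Qed.

Lemma cw_hyperbolic_hiter f n : (0 < n)%N -> cw_hyperbolic f -> cw_hyperbolic (hiter f n).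
Proof.
move=> n0 [[c c0 fc] flps]; split.
  have [c1 c10 H1] := Ws_hiter f n0 c0.
  have [c2 c20 H2] := Ws_hiter (homeo_inv f) n0 c0.
  exists (Num.min c1 c2); first by rewrite lt_min c10.
  move=> x; apply: totally_disconnectedS (fc x) => y [uy sy]; split.
    by apply: H2 => m; apply: le_trans (uy m) _; rewrite ge_min lexx orbT.
  by apply: H1 => m; apply: le_trans (sy m) _; rewrite ge_min lexx.
move=> e /flps [r r0 Hr]; exists r => // x y /Hr [z [zx zy]]; exists z; split.
  by apply: connected_componentS zx => u xu m; rewrite !iter_hiter.
apply: connected_componentS zy => u yu m.
by have := yu (m * n)%N; rewrite -!(@iter_hiter _ _ (homeo_inv f)).
Qed.

Lemma chain_hiter f n e k x y : (0 < n)%N -> 0 <= e ->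
  chain (hiter f n) e k x y -> chain f e (k * n) x y.
Proof.
case: n => // n _ e0; elim: k x => [|k IHk] x.
  by move=> [u [<- <- _]]; exists (fun _ => u 0%N).
move=> /chain_behead [z xz /IHk]; rewrite mulSn; apply: chain_cat.
by rewrite -addn1; apply: chain_cat (chain_orbit f n x e0) _; exact: chain1.
Qed.

Lemma reach_hiter f n x y : (0 < n)%N -> reach (hiter f n) x y -> reach f x y.
Proof.
move=> n0 xy e e0; have /eps_chainP [k k0 c] := xy e e0; apply/eps_chainP.
by exists (k * n)%N; [rewrite muln_gt0 k0|apply: chain_hiter c => //; exact: ltW].
Qed.

Lemma mixing_reach f A x y : (forall z, A z -> A (f z)) -> mixing_on f A ->
  A x -> A y -> reach f x y.
Proof.
move=> fA mA Ax Ay e e0; have e2 : 0 < e / 2 by rewrite divr_gt0.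
have [||N /(_ N (leqnn N))] := mA _ _ (open_mdist_lt (f x) (e / 2)) (open_mdist_lt y (e / 2)).
- by exists (f x); split; [exact: fA|rewrite /= mdistxx].
- by exists y; split; [|rewrite /= mdistxx].
move=> [_ [[w [Aw /= xw] <-] [_ /= yw]]]; apply/eps_chainP; exists N.+1 => //.
rewrite [e]splitr; apply: chain_end; [exact: ltW|by rewrite metric_sym; apply/ltW; exact: yw|].
rewrite -(add1n N); apply: (chain_cat _ (chain_orbit _ _ _ (ltW e2))).
by apply: chain1; exact: ltW.
Qed.

Section Elementary.
Variables (f : homeo X) (C : set X) (n : nat) (D : 'I_n -> set X).
Hypotheses (fcw : cw_hyperbolic f) (fC : chain_recurrent_class f C).
Hypothesis fD : elementary_decomposition f C D.

Lemma elementary_image i : hiter f n @` D i = D i.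
Proof.
have [_ _ _ Df _] := fD.
have It m : iter m f @` D i = D (iter m (@ordS n) i).
  elim: m => [|m IHm]; first by rewrite /= image_id.
  by rewrite iterS -Df -IHm image_comp.
rewrite /= It; congr D; apply: val_inj.
have -> m : val (iter m (@ordS n) i) = ((i + m) %% n)%N.
  elim: m => [|m IHm]; first by rewrite addn0 modn_small.
  by rewrite iterS /= IHm -addn1 modnDml -addnA addn1.
by rewrite /= modnDr modn_small.
Qed.

(** The class of [hiter f n] containing an elementary set lies in the union of
    the elementary sets, and it is transitive, whereas an elementary set is
    invariant and relatively open. *)
Lemma elementary_class i : chain_recurrent_class (hiter f n) (D i).
Proof.
have [n0 [DC Dtriv Dne] Dc _ Dmix] := fD.
have Dinv x : D i x -> D i (hiter f n x).
  by move=> Dx; rewrite -elementary_image; exists x.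
have Dreach x y : D i x -> D i y -> reach (hiter f n) x y.
  exact: mixing_reach (Dmix i).
have [x Dx] := Dne i I; exists x; first exact: Dreach.
have Dcl j : closed (D j) by apply: compact_closed (Dc j); exact: metric_hausdorff.
have DiC j u : D j u -> C u by move=> Du; rewrite -DC; exists j.
apply/seteqP; split=> [y Dy|y [yy xy]].
  by split=> [|e e0]; [exact: Dreach|split; exact: Dreach].
pose C' := [set y | chain_recurrent (hiter f n) y /\ chain_equiv (hiter f n) x y].
have fC' : chain_recurrent_class (hiter f n) C' by exists x => //; exact: Dreach.
have C'C : C' `<=` C.
  move=> u [_ xu]; apply: (class_mem fC (DiC i x Dx)).
    by apply: (reach_hiter n0) => e /xu [].
  by apply: (reach_hiter n0) => e /xu [].
pose U := ~` \bigcup_(j in [set j | j != i]) D j.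
have oU : open U.
  apply: closed_openC; apply: closed_bigcup => //; exact: finite_finset.
apply: contrapT => nDy.
have [||m [_ [[w [C'w Uw] <-] [_ nDw]]]] :=
    class_transitive Xc (cw_hyperbolic_hiter n0 fcw) fC' oU (closed_openC (Dcl i)).
- exists x; split; first by split=> [|e e0]; [exact: Dreach|split; exact: Dreach].
  move=> [j /= ji Dj]; move/negP: ji; apply; apply/eqP.
  by apply: Dtriv => //; exists x.
- by exists y.
have Dw : D i w.
  have : C w by exact: C'C.
  rewrite -DC => -[j _ Dj]; have [<- //|ji] := eqVneq j i.
  by exfalso; apply: Uw; exists j.
by apply: nDw; elim: m => //= m IHm; exact: Dinv.
Qed.

End Elementary.
End Powers.

Section Mixing.
Variables (R : realType) (X : metricType R).
Implicit Types (f : homeo X) (x y z c : X) (A C : set X) (e r g : R) (k l n m : nat).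
Local Notation d := (@mdist R X).
Hypothesis Xc : compact [set: X].

(** Compactness makes the connecting time uniform in both end points. *)
Lemma mixing_connect f A e : closed A -> mixing_on f A -> 0 < e ->
  exists M, forall m x y, (M <= m)%N -> A x -> A y ->
    exists2 c, A c & d c x < e /\ d (iter m f c) y < e.
Proof.
move=> Acl mA e0; apply: contrapT => /forallNP H.
have {}H (M : nat) : exists p : nat * (X * X), [/\ (M <= p.1)%N, A p.2.1, A p.2.2 &
    forall c, A c -> d c p.2.1 < e -> d (iter p.1 f c) p.2.2 < e -> False].
  have /existsNP [m /existsNP [x /existsNP [y]]] := H M.
  move=> /not_implyP[Mm /not_implyP[Ax /not_implyP[Ay nex]]].
  by exists (m, (x, y)); split=> // c Ac cx cy; apply: nex; exists c.
have [p Hp] := choice H; have e2 : 0 < e / 2 by rewrite divr_gt0.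
have [U [PU Uoo Ul]] := ultralimit Xc.
have [x lx] := Ul (fun M => (p M).2.1); have [y ly] := Ul (fun M => (p M).2.2).
have Ax : A x.
  apply: Acl; apply/closure_mdistP => g g0; have [k kx] := filter_ex (lx _ g0).
  by exists (p k).2.1 => //; have [] := Hp k.
have Ay : A y.
  apply: Acl; apply/closure_mdistP => g g0; have [k ky] := filter_ex (ly _ g0).
  by exists (p k).2.2 => //; have [] := Hp k.
have [||N HN] := mA _ _ (open_mdist_lt x (e / 2)) (open_mdist_lt y (e / 2)).
- by exists x; split=> //=; rewrite mdistxx.
- by exists y; split=> //=; rewrite mdistxx.
have [k [Nk [kx ky]]] := filter_ex (filterI (Uoo N) (filterI (lx _ e2) (ly _ e2))).
have [kp _ _ Hk] := Hp k.
have [_ [[c [Ac /= xc] <-] [_ /= yc]]] := HN _ (leq_trans Nk kp).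
apply: (Hk c Ac).
  have := metric_triangle c x (p k).2.1; have := metric_sym c x; move: kx => /=; lra.
have := metric_triangle (iter (p k).1 f c) y (p k).2.2.
have := metric_sym (iter (p k).1 f c) y; move: ky => /=; lra.
Qed.

(** Mixing provides orbits, of any prescribed long enough length, that connect
    the successive pieces of orbits into one pseudo-orbit of the class. *)
Lemma class_specification f A : cw_hyperbolic f -> chain_recurrent_class f A ->
  mixing_on f A -> specification_on f A.
Proof.
move=> fcw fA mA e e0; have [r r0 Hr] := class_shadowing_two_sided Xc fcw fA e0.
have [s s0 Hs] := uniform_continuity Xc (@hfun_continuous _ f) r0.
have Acl : closed A.
  by apply: compact_closed; [exact: metric_hausdorff|exact: (class_compact Xc fA)].
have h0 : 0 < Num.min s r by rewrite lt_min s0.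
have [M HM] := mixing_connect Acl mA h0.
(* gaps of length two or more contain a time of the connecting orbit *)
exists M.+2 => -[|m] a b y ab gap Ay.
  by have [z Az] := class_nonempty fA; exists z.
have Ai i z : A z -> A (hiterz f i z) by exact: (class_hiterz Xc fA).
have glue j : (j < m.+1)%N -> exists p : int -> X,
    [/\ forall i, A (p i), forall i, d (f (p i)) (p (i + 1)) <= r,
        forall j' i, (j' <= j)%N -> a j' <= i <= b j' -> p i = hiterz f i (y j'),
        forall i, a j <= i -> p i = hiterz f i (y j) &
        forall j', (j' <= j)%N -> b j' <= b j].
  elim: j => [|j IHj] jm.
    exists (fun i => hiterz f i (y 0%N)); split=> //.
    - by move=> i; apply: Ai; exact: Ay.
    - by move=> i; rewrite hiterzS mdistxx ltW.
    - by move=> j' i; rewrite leqn0 => /eqP ->.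
    - by move=> j'; rewrite leqn0 => /eqP ->.
  have [p [pA pr pI pa pb]] := IHj (ltnW jm).
  have gapj := gap j jm; have abj := ab j (ltnW jm); have abj1 := ab j.+1 jm.
  have [q [qE Mq q2]] : exists q : nat, [/\ a j.+1 = b j + q%:Z, (M <= q)%N & (1 < q)%N].
    exists (absz (a j.+1 - b j)); clear -gapj; split; lia.
  have [c Ac [cb ca]] := HM q _ _ Mq (Ai (b j) _ (Ay j (ltnW jm))) (Ai (a j.+1) _ (Ay j.+1 jm)).
  move: cb ca; rewrite !lt_min => /andP[cb _] /andP[_ ca].
  pose p' i := if i <= b j then p i else
    if i < a j.+1 then hiterz f (i - b j) c else hiterz f i (y j.+1).
  have p'b i : i <= b j -> p' i = p i by rewrite /p' => ->.
  have p'm i : b j < i -> i < a j.+1 -> p' i = hiterz f (i - b j) c.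
    by rewrite /p' ltNge => /negbTE -> ->.
  have ba : b j < a j.+1 by rewrite qE; clear -q2; lia.
  have p'a i : a j.+1 <= i -> p' i = hiterz f i (y j.+1).
    by move=> ai; rewrite /p' !leNgt (lt_le_trans ba ai) /= ltNge ai.
  exists p'; split=> //.
  - move=> i; rewrite /p'; case: ifP => _; first exact: pA.
    by case: ifP => _; apply: Ai => //; exact: Ay.
  - move=> i; have [bi|ib] := ltP (b j) i.
      have [ai|ia] := leP (a j.+1) i.
        by rewrite !p'a ?hiterzS ?mdistxx ?(ltW r0) // (le_trans ai) // lerDl.
      rewrite (p'm _ bi ia); have [ai1|ia1] := leP (a j.+1) (i + 1); last first.
        rewrite p'm // ?(lt_trans bi) ?ltrDl //.
        by rewrite addrAC hiterzS mdistxx ltW.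
      have aE : i + 1 = a j.+1 by clear -ai1 ia; lia.
      rewrite p'a // -hiterzS addrAC aE qE addrAC subrr add0r.
      by apply: ltW; rewrite -qE.
    rewrite (p'b _ ib); have [ib1|bi1] := leP (i + 1) (b j); first by rewrite p'b.
    have iE : i = b j by clear -bi1 ib; lia.
    rewrite p'm ?iE; last 2 first.
    + by rewrite ltrDl.
    + by rewrite qE ltrD2l; clear -q2; lia.
    rewrite addrAC subrr add0r pa // -[hiterz f 1 c]/(f c).
    by apply/ltW/Hs; rewrite metric_sym.
  - move=> j' i; rewrite leq_eqVlt ltnS => /predU1P[->|j'j] /andP[ai ib].
      exact: p'a.
    rewrite p'b; first by apply: pI => //; rewrite ai.
    exact: le_trans ib (pb _ j'j).
  - have bb : b j <= b j.+1 by apply: le_trans abj1; exact: ltW.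
    move=> j'; rewrite leq_eqVlt ltnS => /predU1P[->|/pb] // h.
    exact: le_trans h bb.
have [p [pA pr pI _ _]] := glue m (ltnSn m).
have [|z Az Hz] := Hr p pr; first by move=> k; exists k, k; split.
by exists z => // j jm i abi; rewrite -(pI j).
Qed.

End Mixing.

(** * Limit shadowing *)

Section LimitShadowing.
Variables (R : realType) (X : metricType R).
Implicit Types (f : homeo X) (x y z v : X) (A C : set X) (e r g : R) (k l n m T : nat).
Local Notation d := (@mdist R X).
Hypothesis Xc : compact [set: X].

(** One-sided limit shadowing is obtained by infinitely many corrections: [a m]
    is the size of the correction number [m], [rad m] a distance at which local
    products of that size exist, and [eps m] a precision of shadowing that makes
    the next correction possible. *)
Section Iteration.
Variables (f : homeo X) (x : nat -> X) (a eps rad : nat -> R).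
Hypothesis a_gt0 : forall m, 0 < a m.
Hypothesis aS : forall m, a m.+1 = a m / 2.
Hypothesis eps_gt0 : forall m, 0 < eps m.
Hypothesis eps_a : forall m, eps m <= a m.
Hypothesis eps_rad : forall m, eps m.+1 + 2 * eps m < rad m.+1.
Hypothesis rad_glue : forall m (t : int) z v, d (hiterz f t z) (hiterz f t v) < rad m ->
  exists w, [/\ forall i, t <= i -> d (hiterz f i z) (hiterz f i w) <= a m,
    forall i, i <= t -> d (hiterz f i v) (hiterz f i w) <= a m &
    forall g, 0 < g -> exists N : nat, forall i, t + N%:Z <= i ->
      d (hiterz f i z) (hiterz f i w) < g].
Hypothesis tail_shadow : forall m, exists N z, forall n, (N <= n)%N ->
  d (iter n f z) (x n) <= eps m.

(** From time [T] on the orbit of [v] is as close to [x] as the corrections allow;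
    the better precision, reached later, prepares the next correction. *)
Definition stage m v T := (forall i, (T <= i)%N -> d (iter i f v) (x i) <= 2 * a m) /\
  exists S, forall i, (S <= i)%N -> d (iter i f v) (x i) <= 2 * eps m.

(** At a late time, replace the future of [v] by that of a point shadowing the
    tail of [x] with the next precision. *)
Lemma next_stage m v T : stage m v T -> exists v' T',
  [/\ stage m.+1 v' T', (T < T')%N &
      forall i, (i <= T')%N -> d (iter i f v) (iter i f v') <= a m.+1].
Proof.
move=> [_ [S vS]]; have [N [z zN]] := tail_shadow m.+1.
have [T' [ST NT TT]] : exists T', [/\ (S <= T')%N, (N <= T')%N & (T < T')%N].
  exists (maxn S (maxn N T.+1)).
  by rewrite !leq_max !leqnn !orbT.
have [|w [zw vw zw0]] := @rad_glue m.+1 T'%:Z z v.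
  have := eps_rad m; have := vS T' ST; have := zN T' NT.
  have := metric_triangle (iter T' f z) (x T') (iter T' f v).
  have := metric_sym (x T') (iter T' f v).
  move: (d _ _) (d _ _) (d _ _) (d _ _) => *; rewrite /=; lra.
exists w, T'; split=> // [|i iT]; last exact: (vw i%:Z).
split=> [i Ti|].
  have := zw i%:Z Ti; have := zN i (leq_trans NT Ti); have := eps_a m.+1.
  have := metric_triangle (iter i f w) (iter i f z) (x i).
  have := metric_sym (iter i f w) (iter i f z); rewrite /=; lra.
have [K HK] := zw0 _ (eps_gt0 m.+1).
exists (T' + K)%N => i Ki; have := zN i; have := HK i%:Z.
have -> : T'%:Z + K%:Z <= i%:Z by rewrite -PoszD lez_nat.
rewrite (leq_trans NT (leq_trans (leq_addr K T') Ki)) => /(_ isT) + /(_ isT).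
have := metric_triangle (iter i f w) (iter i f z) (x i).
have := metric_sym (iter i f w) (iter i f z); rewrite /=; lra.
Qed.

Lemma stages_limit v0 : stage 0 v0 0 -> (forall g, 0 < g -> exists m, a m < g) ->
  exists v, d v (x 0%N) <= 3 * a 0%N /\
    forall g, 0 < g -> exists N, forall n, (N <= n)%N -> d (iter n f v) (x n) < g.
Proof.
move=> st0 a0.
have step (p : nat * (X * nat)) : exists q : X * nat, stage p.1 p.2.1 p.2.2 ->
    [/\ stage p.1.+1 q.1 q.2, (p.2.2 < q.2)%N &
      forall i, (i <= q.2)%N -> d (iter i f p.2.1) (iter i f q.1) <= a p.1.+1].
  have [st|nst] := pselect (stage p.1 p.2.1 p.2.2); last by exists p.2.
  by have [v' [T' H]] := next_stage st; exists (v', T').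
have [s Hs] := choice step.
pose q m := iteri m (fun i u => s (i, u)) (v0, 0%N).
have qs m : stage m (q m).1 (q m).2.
  by elim: m => [|m /(Hs (m, _)) []].
have qT m : ((q m).2 < (q m.+1).2)%N by have [] := Hs (m, _) (qs m).
have qd m i : (i <= (q m.+1).2)%N -> d (iter i f (q m).1) (iter i f (q m.+1).1) <= a m.+1.
  by have [_ _] := Hs (m, _) (qs m); apply.
have qTm m n : (m <= n)%N -> ((q m).2 <= (q n).2)%N.
  elim: n => [|n IHn]; first by rewrite leqn0 => /eqP ->.
  by rewrite leq_eqVlt ltnS => /predU1P[->//|/IHn /leq_trans]; apply; apply/ltnW/qT.
have qmk m k i : (i <= (q m.+1).2)%N ->
    d (iter i f (q m).1) (iter i f (q (m + k)%N).1) <= a m - a (m + k)%N.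
  move=> im; elim: k => [|k IHk]; first by rewrite addn0 mdistxx subrr.
  have := qd (m + k)%N i (leq_trans im (qTm m.+1 (m + k).+1 (leq_addr _ _))).
  rewrite addnS; have := metric_triangle (iter i f (q m).1) (iter i f (q (m + k)%N).1)
    (iter i f (q (m + k).+1).1).
  rewrite aS; lra.
(* the corrections are dominated by a geometric series *)
have [v Hv] := cluster_point Xc (fun m => (q m).1).
have vq m i : (i <= (q m.+1).2)%N -> d (iter i f v) (iter i f (q m).1) <= a m.
  move=> im; apply: mdist_limit_le_cst.
    by apply: iter_continuous; exact: hfun_continuous.
  move=> g g0; have [k mk vk] := Hv g m g0; exists (q k).1 => //.
  have := qmk m (k - m)%N i im; rewrite subnKC // metric_sym.
  have := a_gt0 k; lra.
have vx m i : ((q m).2 <= i)%N -> (i <= (q m.+1).2)%N -> d (iter i f v) (x i) <= 3 * a m.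
  move=> mi im; have [/(_ i mi) + _] := qs m; have := vq m i im.
  have := metric_triangle (iter i f v) (iter i f (q m).1) (x i); lra.
exists v; split; first exact: (vx 0%N 0%N).
have am m n : (m <= n)%N -> a n <= a m.
  elim: n => [|n IHn]; first by rewrite leqn0 => /eqP ->.
  by rewrite leq_eqVlt ltnS => /predU1P[->//|/IHn]; rewrite aS; have := a_gt0 n; lra.
move=> g g0; have [m mg] := a0 (g / 3) (divr_gt0 g0 (ltr0n _ 3)).
exists (q m).2 => i mi.
have exk : exists k, (i < (q k.+1).2)%N.
  have qk k : (k <= (q k).2)%N by elim: k => // k /leq_ltn_trans; apply.
  by exists i; apply: qk.
case: (ex_minnP exk) => k ik kmin.
have ki : ((q k).2 <= i)%N.
  case: k ik kmin => [|k] ik kmin; first exact: leq0n.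
  by rewrite leqNgt; apply/negP => /kmin; rewrite ltnn.
have mk : (m <= k)%N.
  by rewrite leqNgt; apply/negP => /qTm km; have := leq_trans (leq_trans ik km) mi; rewrite ltnn.
by have := vx k i ki (ltnW ik); have := am m k mk; lra.
Qed.

End Iteration.

(** Correct the shadowing point again and again, at later and later times, by
    local products on finer and finer scales: every correction makes the tail
    of the orbit closer to the pseudo-orbit and disturbs the earlier part only
    by a term of a geometric series. *)
Lemma limit_shadowing f : cw_hyperbolic f -> forall e, 0 < e -> exists2 r, 0 < r &
  forall x : nat -> X, (forall n, d (f (x n)) (x n.+1) <= r) ->
  (forall g, 0 < g -> exists N, forall n, (N <= n)%N -> d (f (x n)) (x n.+1) < g) ->
  exists v, d v (x 0%N) <= e /\
    forall g, 0 < g -> exists N, forall n, (N <= n)%N -> d (iter n f v) (x n) < g.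
Proof.
move=> fcw e e0.
pose a m : R := e / 3 * (1 / 2 ^+ m).
have a_gt0 m : 0 < a m by rewrite mulr_gt0 ?divr_gt0 // exprn_gt0.
have aS m : a m.+1 = a m / 2 by rewrite /a exprS; field; rewrite expf_neq0 // pnatr_eq0.
have /choice [rad radP] (m : nat) : exists r, 0 < r /\
    forall (t : int) z v, d (hiterz f t z) (hiterz f t v) < r ->
    exists w, [/\ forall i, t <= i -> d (hiterz f i z) (hiterz f i w) <= a m,
      forall i, i <= t -> d (hiterz f i v) (hiterz f i w) <= a m &
      forall g, 0 < g -> exists N : nat, forall i, t + N%:Z <= i ->
        d (hiterz f i z) (hiterz f i w) < g].
  have [r [N [r0 H]]] := local_product_at Xc fcw (a_gt0 m).
  exists r; split=> // t z v /H [w [h1 h2 h3 _]]; exists w; split=> // g g0.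
  by exists (N g) => i; exact: h3.
pose eps m := Num.min (a m) (Num.min (rad m / 4) (rad m.+1 / 4)).
have eps_gt0 m : 0 < eps m.
  by rewrite !lt_min a_gt0 !divr_gt0 ?ltr0n ?(radP _).1.
have [eps_a eps_r eps_r'] : [/\ forall m, eps m <= a m, forall m, eps m <= rad m / 4 &
    forall m, eps m <= rad m.+1 / 4].
  by split=> m; rewrite /eps !ge_min lexx ?orbT.
have eps_rad m : eps m.+1 + 2 * eps m < rad m.+1.
  by have := eps_r m.+1; have := eps_r' m; have [+ _] := radP m.+1; lra.
have /choice [sh shP] (m : nat) : exists r, 0 < r /\ forall x : nat -> X,
    (forall k, d (f (x k)) (x k.+1) <= r) -> exists w, forall k, d (iter k f w) (x k) <= eps m.
  by have [r r0 H] := shadowing Xc fcw (eps_gt0 m); exists r.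
exists (sh 0%N); first by have [] := shP 0%N.
move=> x xr x0.
have tail m : exists N z, forall n, (N <= n)%N -> d (iter n f z) (x n) <= eps m.
  have [sh0 Hsh] := shP m; have [N HN] := x0 _ sh0.
  have [|w Hw] := Hsh (fun k => x (N + k)%N).
    by move=> k; rewrite addnS; apply: ltW; apply: HN; rewrite leq_addr.
  exists N, (iter N (hinv f) w) => n Nn.
  have := Hw (n - N)%N; rewrite subnKC // => h; apply: le_trans h.
  by rewrite -{1}(subnK Nn) iterD iter_hinvK.
have [v0 Hv0] := (shP 0%N).2 x xr.
have st0 : stage f x a eps 0 v0 0.
  split=> [i _|]; last by exists 0%N => i _; have := Hv0 i; have := eps_gt0 0%N; lra.
  by have := Hv0 i; have := eps_a 0%N; have := a_gt0 0%N; lra.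
have [|v [vx Hv]] := stages_limit a_gt0 aS eps_gt0 eps_a eps_rad (fun m => (radP m).2) tail st0.
  move=> g g0; have g3 : 0 < g / (e / 3) by rewrite !divr_gt0.
  have [N _ HN] := near_infty_natSinv_expn_lt (PosNum g3).
  exists N; have /= := HN N (leqnn N); rewrite ltr_pdivlMr ?divr_gt0 //.
  by rewrite /a mulrC.
exists v; split=> //; apply: le_trans vx _; rewrite /a expr0; lra.
Qed.

Lemma vanishes_at_infinityP (u : int -> R) : (forall i, 0 <= u i) ->
  vanishes_at_infinity u <-> (forall g, 0 < g -> exists N : nat, forall i : int,
    (N <= `|i|)%N -> u i < g).
Proof.
move=> u0.
have oneP (w : nat -> R) : (forall n, 0 <= w n) -> (w n @[n --> \oo] --> (0 : R)) <->
    (forall g, 0 < g -> exists N : nat, forall n, (N <= n)%N -> w n < g).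
  move=> w0; split=> [/cvgrPdist_lt wl g /wl [N _ HN]|H].
    by exists N => n /HN; rewrite /= sub0r normrN ger0_norm.
  apply/cvgrPdist_lt => g /H [N HN]; exists N => // n /= /HN.
  by rewrite sub0r normrN ger0_norm.
split=> [[/oneP up /oneP un] g g0|H].
  have [N HN] := up (fun n => u0 _) g g0; have [M HM] := un (fun n => u0 _) g g0.
  exists (maxn N M) => -[] n; rewrite geq_max => /andP[Nn Mn]; first exact: HN.
  by rewrite NegzE; apply: HM.
split; apply/oneP => // g /H [N HN]; exists N => n Nn; apply: HN => //.
by rewrite abszN.
Qed.

(** Limit shadowing applied to [f] and to its inverse gives points asymptotic to
    the two ends of the sequence.  A mixing orbit [c] of the right length goes
    from near the first one to near the second one, and two local products, one
    at each end of [c], yield a point asymptotic to both. *)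
Lemma class_limit_shadowing f A : cw_hyperbolic f -> chain_recurrent_class f A ->
  mixing_on f A -> two_sided_limit_shadowing_on f A.
Proof.
move=> fcw fA mA y Ay /vanishes_at_infinityP ylim.
have {}ylim := ylim (fun i => mdist_ge0 _ _).
have Acl : closed A.
  by apply: compact_closed; [exact: metric_hausdorff|exact: (class_compact Xc fA)].
have [r1 [N1 [r10 H1]]] := local_product_at Xc fcw (@ltr01 R).
have [r2 [N2 [r20 H2]]] := local_product_at Xc fcw (divr_gt0 r10 (ltr0n _ 4)).
have [p [p0 p1 p2]] : exists p, [/\ 0 < p, p <= r1 / 4 & p <= r2 / 4].
  by exists (Num.min (r1 / 4) (r2 / 4)); rewrite lt_min !divr_gt0 // !ge_min !lexx orbT.
have [s1 s10 Hs1] := limit_shadowing fcw p0.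
have [s2 s20 Hs2] := limit_shadowing (cw_hyperbolic_inv fcw) p0.
have ylim' g : 0 < g -> exists N : nat, forall i : int, (N <= `|i|)%N ->
    d (hinv f (y (i + 1))) (y i) < g.
  move=> g0; have [s s0 Hs] := uniform_continuity Xc (@hinv_continuous _ f) g0.
  have [N HN] := ylim s s0; exists N => i /HN ys.
  by have := Hs (y (i + 1)) (f (y i)); rewrite hfunK metric_sym; apply.
have [M HM] := mixing_connect Xc Acl mA p0.
have [T1 HT1] := ylim s1 s10; have [T2 HT2] := ylim' s2 s20.
have [T [T1T T2T MT]] : exists T : nat, [/\ (T1 <= T)%N, (T2 <= T)%N & (M <= T + T)%N].
  exists (maxn T1 (maxn T2 M)); rewrite !leq_max !leqnn !orbT /=; split=> //.
  by rewrite (leq_trans _ (leq_addr _ _)) // !leq_max leqnn !orbT.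
have [||v [vy Hv]] := Hs1 (fun n => y (T + n)%N).
- by move=> n; rewrite addnS -addn1 PoszD; apply/ltW/HT1; rewrite (leq_trans T1T) ?leq_addr.
- move=> g /ylim [N HN]; exists N => n Nn; rewrite addnS -addn1 PoszD; apply: HN.
  by rewrite (leq_trans Nn) ?leq_addl.
have backE n : y (- (T + n)%N%:Z) = y (- (T + n.+1)%N%:Z + 1).
  by congr y; rewrite addnS -addn1 (PoszD _ 1%N) opprD addrNK.
have [||u [uy Hu]] := Hs2 (fun n => y (- (T + n)%N%:Z)).
- by move=> n; rewrite backE; apply/ltW/HT2; rewrite abszN (leq_trans T2T) ?leq_addr.
- move=> g /ylim' [N HN]; exists N => n Nn; rewrite backE; apply: HN.
  by rewrite abszN (leq_trans Nn) // addnS leqW // leq_addl.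
rewrite !addn0 in vy uy.
have [c Ac [cy cy']] := HM _ _ _ MT (Ay (- T%:Z)) (Ay T).
have shiftE i j z : hiterz f i (hiterz f j z) = hiterz f (i + j) z by rewrite hiterzD.
have [|q [q1 q2 q3 q4]] := H2 (- T%:Z) (hiterz f T c) (hiterz f T u).
  rewrite !shiftE addNr /=.
  have := metric_triangle c (y (- T%:Z)) u; have := metric_sym (y (- T%:Z)) u.
  clear -cy uy p2 p0 r20; lra.
have [|z [z1 z2 z3 z4]] := H1 T%:Z (hiterz f (- T%:Z) v) q.
  rewrite shiftE subrr /=; have := q1 T%:Z; rewrite shiftE -PoszD /=.
  have -> : - T%:Z <= T%:Z by clear; lia.
  move=> /(_ isT).
  have := metric_triangle v (y T) (iter T f q).
  have := metric_triangle (y T) (iter (T + T) f c) (iter T f q).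
  have := metric_sym (y T) (iter (T + T) f c).
  clear -cy' vy p1 r10; lra.
have zy : forall g, 0 < g -> exists N : nat, forall i : int, (N <= `|i|)%N ->
    d (hiterz f i z) (y i) < g.
  move=> g g0; have g3 : 0 < g / 3 by rewrite divr_gt0.
  have [Nv HNv] := Hv _ g3; have [Nu HNu] := Hu _ g3.
  have [N [NNv NNu NN1 NN2]] : exists N : nat, [/\ (T + Nv <= N)%N, (T + Nu <= N)%N,
      (T + N1 (g / 3)%R <= N)%N & (T + N2 (g / 3)%R <= N)%N].
    exists (T + Nv + Nu + N1 (g / 3)%R + N2 (g / 3)%R)%N; clear; split; lia.
  exists N => i Ni; have [i0|i0] := leP 0 i.
    have : d (hiterz f i (hiterz f (- T%:Z) v)) (hiterz f i z) < g / 3.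
      by apply: z3 => //; clear -i0 Ni NN1; lia.
    have [n iE] : exists n, i = (T + n)%N%:Z.
      by exists (absz i - T)%N; clear -i0 Ni NNv; lia.
    have : d (iter n f v) (y i) < g / 3.
      by rewrite iE; apply: HNv; clear -iE Ni NNv; lia.
    rewrite shiftE.
    have -> : hiterz f (i - T%:Z) v = iter n f v by rewrite iE PoszD addrAC subrr add0r.
    have := metric_triangle (hiterz f i z) (iter n f v) (y i).
    have := metric_sym (hiterz f i z) (iter n f v).
    clear -g0; lra.
  have : d (hiterz f i q) (hiterz f i z) < g / 3.
    by apply: z4 => //; clear -i0 Ni NN1; lia.
  have : d (hiterz f i (hiterz f T u)) (hiterz f i q) < g / 3.
    by apply: q4 => //; clear -i0 Ni NN2; lia.
  have [n iE] : exists n, i = - (T + n)%N%:Z.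
    by exists (absz i - T)%N; clear -i0 Ni NNu; lia.
  have : d (iter n (hinv f) u) (y i) < g / 3.
    by rewrite iE; apply: HNu; clear -iE Ni NNu; lia.
  rewrite shiftE.
  have -> : hiterz f (i + T) u = iter n (hinv f) u.
    by rewrite iE PoszD opprD addrAC addNr add0r hiterzN.
  have := metric_triangle (hiterz f i z) (hiterz f i q) (y i).
  have := metric_triangle (hiterz f i q) (iter n (hinv f) u) (y i).
  have := metric_sym (hiterz f i z) (hiterz f i q).
  have := metric_sym (hiterz f i q) (iter n (hinv f) u).
  clear -g0; lra.
exists z; last by apply/vanishes_at_infinityP => // i; exact: mdist_ge0.
(* [z] is in the class because its orbit approaches the class at both ends *)
apply: (class_mem fA (Ay 0)) => g g0.
  have [N HN] := zy g g0; pose w := hinv f (y (- N%:Z)).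
  have Aw : A w by apply: (class_hinv Xc fA); exact: Ay.
  apply: eps_chain_trans (class_reach fA (Ay 0) Aw g0) _.
  apply/eps_chainP; exists (1 + N)%N => //.
  apply: (chain_cat (y := iter N (hinv f) z)).
    by apply: chain1; rewrite /w hinvK metric_sym -hiterzN; apply/ltW/HN; rewrite abszN.
  by rewrite -{2}(iter_hinvK f N z); apply: chain_orbit; exact: ltW.
have [N HN] := zy (g / 2) (divr_gt0 g0 (ltr0n _ 2)).
apply: eps_chain_trans _ (class_reach fA (Ay N.+1) (Ay 0) g0).
apply/eps_chainP; exists N.+1 => //; rewrite [g]splitr.
apply: (chain_end (y := iter N.+1 f z)); first by rewrite ltW // divr_gt0.
  by apply/ltW/(HN N.+1).
by apply: chain_orbit; rewrite ltW // divr_gt0.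
Qed.

End LimitShadowing.

Theorem corollary2p2 (R : realType) (X : metricType R) (f : homeo X)
    (Xpeano : peano_continuum X) (fcw : cw_hyperbolic f) :
  [/\ finite_set [set C : set X | chain_recurrent_class f C],
      (forall C : set X, chain_recurrent_class f C ->
         expansive_on f C \/ small_td_semihorseshoes f C),
      (forall C : set X, chain_recurrent_class f C ->
         transitive_on f C /\
         exists (n : nat) (D : 'I_n -> set X),
           elementary_decomposition f C D) &
      (forall C : set X, chain_recurrent_class f C ->
         forall (n : nat) (D : 'I_n -> set X),
           elementary_decomposition f C D ->
           forall i : 'I_n,
             [/\ mixing_on (hiter f n) (D i),
                 specification_on (hiter f n) (D i) &
                 two_sided_limit_shadowing_on (hiter f n) (D i)])].
Proof.
have [Xc _ _] := Xpeano; split.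
- exact: finite_classes.
- move=> C fC; have [|nexp] := pselect (expansive_on f C); first by left.
  by right; exact: class_semihorseshoes.
- move=> C fC; split; first exact: class_transitive.
  by have [x Cx] := class_nonempty fC; exact: (class_decomposition Xc fcw fC Cx).
- move=> C fC n D fD i; have [n0 _ _ _ Dmix] := fD.
  have gcw := cw_hyperbolic_hiter Xc n0 fcw.
  have gD := elementary_class Xc fcw fC fD i.
  by split; [exact: Dmix|exact: class_specification|exact: class_limit_shadowing].
Qed.
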